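(* Let $\Pi_1,\Pi_2,\Pi_3$ be planar networks of rank $n$. If $(\lambda,\mu,\nu,\rho,\sigma,\tau)\in \mathrm{mHorn}^{\Pi_1,\Pi_2,\Pi_3}$, then the trace equalities $$\sum_i\lambda_i+\sum_i\mu_i=\sum_i\rho_i,\qquad \sum_i\mu_i+\sum_i\nu_i=\sum_i\sigma_i,\qquad \sum_i\lambda_i+\sum_i\mu_i+\sum_i\nu_i=\sum_i\tau_i$$ hold, and there exist real numbers $m_{i,j,k}$, $(i,j,k)\in\Delta^3(n)$, such that: (1) (boundary values) $m_{0,0,0}=0$ and, for $0\le l\le n$, $$m_{l,0,0}=\sum_{r\le l}\lambda_r,\quad m_{n-l,l,0}=\sum_{r=1}^n\lambda_r+\sum_{r\le l}\mu_r,\quad m_{0,n-l,l}=\sum_{r=1}^n\lambda_r+\sum_{r=1}^n\mu_r+\sum_{r\le l}\nu_r,$$ $$m_{0,l,0}=\sum_{r\le l}\rho_r,\quad m_{n-l,0,l}=\sum_{r=1}^n\lambda_r+\sum_{r\le l}\sigma_r,\quad m_{0,0,l}=\sum_{r\le l}\tau_r;$$ (2) (rhombus inequalities) for every small rhombus in $\Delta^3(n)$, the sum of the values of $m$ at the endpoints of the short diagonal is greater than or equal to the sum of the values at the endpoints of the long diagonal; (3) (tetrahedron equalities) for all integers $i,j,k\ge 0$ with $i+j+k\le n-2$, setting $$\alpha=m_{i+1,j,k}+m_{i,j+1,k+1},\quad \beta=m_{i+1,j+1,k}+m_{i,j,k+1},\quad \gamma=m_{i,j+1,k}+m_{i+1,j,k+1},$$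 one has $$\alpha\le\max\{\beta,\gamma\},\qquad \beta\le\max\{\gamma,\alpha\},\qquad \gamma\le\max\{\alpha,\beta\}.$$
   Context: **Planar networks.** $\mathbb T=\mathbb R\cup\{-\infty\}$. A planar network of rank $n$ is a finite planar graph embedded in a strip $0\le x\le r$ with no vertical edges, oriented from left to right, with $n$ sources on the line $x=0$ and $n$ sinks on the line $x=r$, each labelled $1,\dots,n$ from bottom to top. A weighting of $\Pi$ is a map $w$ from the edges of $\Pi$ to $\mathbb T$; $\mathbb T^\Pi$ is the set of weightings. The concatenation $\Pi_1\circ\Pi_2$ is obtained by gluing the $i$-th sink of $\Pi_1$ to the $i$-th source of $\Pi_2$; $w_1\circ w_2$ is the induced weighting. An $l$-path in $\Pi$ is a collection of $l$ pairwise vertex-disjoint oriented paths from sources to sinks of $\Pi$; its weight is the sum of the weights of all its edges. $m(\Pi,w)\in\mathbb T^n$ is the vector whose $l$-th component is the maximal weight of an $l$-path in $\Pi$ ($-\infty$ if there is none). **The set.** For $\lambda\in\mathbb R^n$ let $L(\lambda)=(\lambda_1,\lambda_1+\lambda_2,\dots,\lambda_1+\dots+\lambda_n)$. Then $\mathrm{mHorn}^{\Pi_1,\Pi_2,\Pi_3}\subset\mathbb R^{6n}$ is the set of $(\lambda,\mu,\nu,\rho,\sigma,\tau)$ for which there exist $w_i\in\mathbb T^{\Pi_i}$ ($i=1,2,3$) with $L(\lambda)=m(\Pi_1,w_1)$, $L(\mu)=m(\Pi_2,w_2)$, $L(\nu)=m(\Pi_3,w_3)$, $L(\rho)=m(\Pi_1\circ\Pi_2,w_1\circ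 w_2)$, $L(\sigma)=m(\Pi_2\circ\Pi_3,w_2\circ w_3)$, $L(\tau)=m(\Pi_1\circ\Pi_2\circ\Pi_3,w_1\circ w_2\circ w_3)$. **Tetrahedron and rhombi.** $\Delta^3(n)=\{(x_1,x_2,x_3)\in\mathbb Z_{\ge0}^3: x_1+x_2+x_3\le n\}$. Setting $x_0=n-x_1-x_2-x_3$, identify it with $\{x\in\mathbb Z_{\ge0}^{4}: x_0+x_1+x_2+x_3=n\}$, with standard basis vectors $e_0,\dots,e_3$ of $\mathbb Z^4$. The small rhombi are the images of the rhombus with vertices $(0,0,0),(1,0,0),(1,1,0),(0,1,0)$ (long diagonal $(0,0,0),(1,1,0)$; short diagonal $(1,0,0),(0,1,0)$) under the $S_4$-symmetries of the tetrahedron and translations. Explicitly, for pairwise distinct $a,b,c\in\{0,1,2,3\}$ and $y\in\mathbb Z_{\ge 0}^4$ with $\sum y_i=n-2$, there is a small rhombus with short diagonal $\{y+e_a+e_b,\ y+e_a+e_c\}$ and long diagonal $\{y+2e_a,\ y+e_b+e_c\}$. *)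

(* Defs.v *)
From mathcomp Require Import all_boot all_order all_algebra.
From mathcomp Require Import all_classical all_reals all_analysis.
Set Implicit Arguments.
Unset Strict Implicit.
Unset Printing Implicit Defensive.
Import Order.TTheory GRing.Theory Num.Theory.
Import numFieldNormedType.Exports.
Local Open Scope classical_set_scope.
Local Open Scope ring_scope.

(* The combinatorial data of a network of rank n: path weights and
   concatenation depend only on these. Labels 1, ..., n become 0, ..., n-1. *)
Record network (n : nat) := Network {
  vertex : finType;
  edge : finType;
  src : edge -> vertex;
  tgt : edge -> vertex;
  source : 'I_n -> vertex;
  sink : 'I_n -> vertex }.

Arguments src {n N} _ : rename.
Arguments tgt {n N} _ : rename.
Arguments source {n N} _ : rename.
Arguments sink {n N} _ : rename.

Section Planar.
Variable R : realType.

(* An embedding in the strip 0 <= x <= width. As edges are oriented from left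
   to right and never vertical, the edge e is drawn as the graph of a
   continuous function [curve e] over the interval [x (src e), x (tgt e)];
   straight segments are a special case. *)
Record planar_embedding (n : nat) (N : network n) := PlanarEmbedding {
  width : R;
  xcoord : vertex N -> R;
  ycoord : vertex N -> R;
  curve : edge N -> R -> R;
  width_gt0 : 0 < width;
  strip : forall v, 0 <= xcoord v <= width;
  position_inj : forall u v,
    xcoord u = xcoord v -> ycoord u = ycoord v -> u = v;
  left_to_right : forall e, xcoord (src e) < xcoord (tgt e);
  curve_continuous : forall e,
    {within `[xcoord (src e), xcoord (tgt e)], continuous (curve e)};
  curve_src : forall e, curve e (xcoord (src e)) = ycoord (src e);
  curve_tgt : forall e, curve e (xcoord (tgt e)) = ycoord (tgt e);
  vertex_off_curve : forall e v,
    xcoord (src e) <= xcoord v <= xcoord (tgt e) ->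
    curve e (xcoord v) = ycoord v -> v = src e \/ v = tgt e;
  curves_meet : forall e f t, e != f ->
    xcoord (src e) <= t <= xcoord (tgt e) ->
    xcoord (src f) <= t <= xcoord (tgt f) ->
    curve e t = curve f t ->
    exists v, [/\ v = src e \/ v = tgt e, v = src f \/ v = tgt f
                & xcoord v = t];
  source_left : forall i, xcoord (source i) = 0;
  sink_right : forall i, xcoord (sink i) = width;
  source_bottom_to_top : forall i j : 'I_n, (i < j)%N ->
    ycoord (source (N := N) i) < ycoord (source (N := N) j);
  sink_bottom_to_top : forall i j : 'I_n, (i < j)%N ->
    ycoord (sink (N := N) i) < ycoord (sink (N := N) j) }.

Record planar_network (n : nat) := PlanarNetwork {
  underlying :> network n;
  embedding : planar_embedding underlying }.

End Planar.

Section Concatenation.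
Variables (n : nat) (N1 N2 : network n).

(* The vertices of N2 other than its sources; the sources are represented by
   the sinks of N1 they are glued to. *)
Definition nonsource := {v : vertex N2 | v \notin codom (@source n N2)}.

Definition glue (v : vertex N2) : vertex N1 + nonsource :=
  match boolP (v \in codom (@source n N2)) with
  | AltTrue v_source => inl (sink (iinv v_source))
  | AltFalse v_nonsource => inr (exist _ v v_nonsource)
  end.

Definition concat : network n := {|
  vertex := (vertex N1 + nonsource)%type;
  edge := (edge N1 + edge N2)%type;
  src := fun e =>
    match e with inl e1 => inl (src e1) | inr e2 => glue (src e2) end;
  tgt := fun e =>
    match e with inl e1 => inl (tgt e1) | inr e2 => glue (tgt e2) end;
  source := fun i => inl (source i);
  sink := fun i => glue (sink i) |}.

Definition concat_weight (T : Type) (w1 : edge N1 -> T) (w2 : edge N2 -> T) :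
    edge concat -> T :=
  fun e => match e with inl e1 => w1 e1 | inr e2 => w2 e2 end.

End Concatenation.

Section Paths.
Variables (n : nat) (N : network n).

(* [(v, s)] stands for the walk that starts at v and follows the edges of s. *)
Definition walk := (vertex N * seq (edge N))%type.

Fixpoint chain (v : vertex N) (s : seq (edge N)) : bool :=
  if s is e :: s' then (src e == v) && chain (tgt e) s' else true.

Definition visited (p : walk) : seq (vertex N) := p.1 :: map tgt p.2.

Definition source_sink_path (p : walk) : bool :=
  [&& chain p.1 p.2, p.1 \in codom (@source n N)
    & last p.1 (map tgt p.2) \in codom (@sink n N)].

Definition is_lpath (l : nat) (P : 'I_l -> walk) : Prop :=
  (forall a, source_sink_path (P a)) /\
  (forall a b, a != b ->
     forall v, v \in visited (P a) -> v \notin visited (P b)).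

End Paths.

Section Horn.
Variable R : realType.

(* R with -oo added is the part of \bar R below +oo. *)
Definition weighting (n : nat) (N : network n) (w : edge N -> \bar R) : Prop :=
  forall e, (w e < +oo)%E.

Definition lpath_weight (n : nat) (N : network n) (w : edge N -> \bar R)
    (l : nat) (P : 'I_l -> walk N) : \bar R :=
  (\sum_(a < l) \sum_(e <- (P a).2) w e)%E.

(* Networks of interest are acyclic, hence have finitely many l-paths: the
   supremum is a maximum, and it is -oo when there is no l-path. *)
Definition max_weight (n : nat) (N : network n) (w : edge N -> \bar R)
    (l : nat) : \bar R :=
  ereal_sup [set lpath_weight w P | P in [set P : 'I_l -> walk N | is_lpath P]].

Definition max_weights (n : nat) (N : network n) (w : edge N -> \bar R) :
    'rV[\bar R]_n :=
  \row_(l < n) max_weight w l.+1.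

(* The sum of the first l entries of v; l may be 0. *)
Definition partial_sum (n : nat) (v : 'rV[R]_n) (l : nat) : R :=
  \sum_(r < n | (r < l)%N) v 0 r.

Definition partial_sums (n : nat) (v : 'rV[R]_n) : 'rV[R]_n :=
  \row_(l < n) partial_sum v l.+1.

Definition has_max_weights (n : nat) (N : network n) (w : edge N -> \bar R)
    (v : 'rV[R]_n) : Prop :=
  map_mx EFin (partial_sums v) = max_weights w.

Definition mHorn (n : nat) (N1 N2 N3 : network n)
    (lambda mu nu rho sigma tau : 'rV[R]_n) : Prop :=
  exists (w1 : edge N1 -> \bar R) (w2 : edge N2 -> \bar R)
         (w3 : edge N3 -> \bar R),
    [/\ weighting w1, weighting w2 & weighting w3] /\
    [/\ has_max_weights w1 lambda, has_max_weights w2 mu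
      & has_max_weights w3 nu] /\
    [/\ has_max_weights (concat_weight w1 w2) rho,
        has_max_weights (concat_weight w2 w3) sigma
      & has_max_weights (concat_weight (concat_weight w1 w2) w3) tau].

(* A point (x_0, x_1, x_2, x_3) with x_0 + x_1 + x_2 + x_3 = n of the
   tetrahedron carries the value m x_1 x_2 x_3. *)
Definition value_at (m : nat -> nat -> nat -> R) (x : 'rV[nat]_4) : R :=
  m (x 0 1) (x 0 2) (x 0 3).

Definition unit_vec (a : 'I_4) : 'rV[nat]_4 := delta_mx 0 a.

Definition small_rhombus (n : nat) (short1 short2 long1 long2 : 'rV[nat]_4) :
    Prop :=
  exists (a b c : 'I_4) (y : 'rV[nat]_4),
    [/\ a != b, b != c & a != c] /\
    (\sum_(i < 4) y 0%R i + 2 = n)%N /\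
    [/\ short1 = y + unit_vec a + unit_vec b,
        short2 = y + unit_vec a + unit_vec c,
        long1 = y + unit_vec a *+ 2
      & long2 = y + unit_vec b + unit_vec c].

End Horn.

(* Main.v *)
Require Import Defs.
From mathcomp Require Import all_boot all_order all_algebra.
From mathcomp Require Import fingroup perm zify.
From mathcomp Require Import all_classical all_reals all_analysis.
Set Implicit Arguments.
Unset Strict Implicit.
Unset Printing Implicit Defensive.
Import Defs.
Import Order.TTheory GRing.Theory Num.Theory.
Local Open Scope ring_scope.

(* Planarity only serves to give a height that increases along the edges. Let
   m(i,j,k) be the maximal weight of a family of disjoint paths starting at
   sources of P1, of which i stop at the sinks of P1, j at those of P2 and k at
   those of P3; together with the unused sources this makes n terminals, each
   in one of four classes. A family is a permutation of the vertices, with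
   fixed points at the unvisited vertices and with every path closed up through
   a source, so m is the tropical permanent of a matrix in which the column of
   a source only depends on the class of its terminal. Superposing optimal
   permutations for two choices of classes and exchanging them along an
   alternating path gives, for classes a, b, c, d and a multiset y,
     m(y+a+d) + m(y+b+c) <= max (m(y+b+d) + m(y+a+c), m(y+c+d) + m(y+a+b)),
   the three-term tropical Pluecker relation. With d = a it is the rhombus
   inequality, with four distinct classes the tetrahedron equality. On the
   boundary the matrix is block triangular. *)

(** * Tropical permanents *)

Section TropicalPermanent.
Variable R : realType.
Local Open Scope ereal_scope.

(** Rows and columns may have different index types, so that blocks of a matrix are covered as well.
    The default [-oo] is the value when there is no injection. *)
Definition tper (A B : finType) (C : A -> B -> \bar R) : \bar R :=
  \big[maxe/-oo]_(f : {ffun A -> B} | injectiveb f) \sum_a C a (f a).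

Lemma tper_ge (A B : finType) (C : A -> B -> \bar R) (f : A -> B) :
  injective f -> \sum_a C a (f a) <= tper C.
Proof.
move=> f_inj; rewrite (eq_bigr (fun a => C a ([ffun x => f x] a))); last first.
  by move=> a _; rewrite ffunE.
apply: (@le_bigmax_cond _ _ _ _ [ffun x => f x] (fun f => injectiveb f)
  (fun f : {ffun A -> B} => \sum_a C a (f a))).
by apply/injectiveP => x y; rewrite !ffunE; apply: f_inj.
Qed.

Lemma tper_le (A B : finType) (C : A -> B -> \bar R) (x : \bar R) :
  (forall f : A -> B, injective f -> \sum_a C a (f a) <= x) -> tper C <= x.
Proof.
move=> h; apply: bigmax_le; first exact: leNye.
by move=> f /injectiveP f_inj; apply: h.
Qed.

Lemma eq_tper (A B : finType) (C C' : A -> B -> \bar R) :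
  (forall a b, C a b = C' a b) -> tper C = tper C'.
Proof.
by move=> h; apply: eq_bigr => f _; apply: eq_bigr => a _; rewrite h.
Qed.

Lemma tper_attained (A B : finType) (C : A -> B -> \bar R) :
  #|A| = #|B| -> exists2 f : A -> B, injective f & tper C = \sum_a C a (f a).
Proof.
move=> AB.
pose f0 (a : A) : B := enum_val (cast_ord AB (enum_rank a)).
have f0_inj : injective f0.
  by move=> x y /enum_val_inj/cast_ord_inj/enum_rank_inj.
have f0P : injectiveb [ffun x => f0 x].
  by apply/injectiveP => x y; rewrite !ffunE; apply: f0_inj.
have [f fP e] := @eq_bigmax _ _ _ -oo [ffun x => f0 x]
  (fun f : {ffun A -> B} => injectiveb f)
  (fun f : {ffun A -> B} => \sum_a C a (f a)) f0P (fun f _ => leNye _).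
by exists f; [apply/injectiveP|exact: e].
Qed.

Lemma tper_reindex (A B A' B' : finType) (phi : A' -> A) (psi : B' -> B)
    (C : A -> B -> \bar R) :
  bijective phi -> bijective psi ->
  tper C = tper (fun a b => C (phi a) (psi b)).
Proof.
move=> [phi' phiK phi'K] [psi' psiK psi'K]; apply/le_anti/andP; split.
  apply: tper_le => f f_inj.
  rewrite (reindex phi) /=; last by exists phi' => x _.
  rewrite (eq_bigr (fun a => C (phi a) (psi (psi' (f (phi a)))))); last first.
    by move=> a _; rewrite psi'K.
  apply: (tper_ge (fun a b => C (phi a) (psi b))
    (f := fun a => psi' (f (phi a)))).
  by move=> x y /(can_inj psi'K)/f_inj/(can_inj phiK).
apply: tper_le => f f_inj.
rewrite (reindex phi') /=; last by exists phi => x _.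
rewrite (eq_bigr (fun a => C a (psi (f (phi' a))))); last first.
  by move=> a _; rewrite phi'K.
apply: (tper_ge C (f := fun a => psi (f (phi' a)))).
by move=> x y /(can_inj psiK)/f_inj/(can_inj phi'K).
Qed.

(** [-oo] absorbs every summand, [+oo] included, so one forbidden entry kills a whole term of the
    permanent. *)
Lemma sume_eqNy (I : finType) (F : I -> \bar R) (i : I) :
  F i = -oo -> \sum_j F j = -oo.
Proof. by move=> h; rewrite (bigD1 i) //= h addNye. Qed.

(** An injection avoiding the [-oo] block maps [A1] into [B1], hence onto it by cardinality, and
    leaves only [B2] to [A2]. The opposite off-diagonal block never contributes. *)
Lemma tper_block (A1 A2 B1 B2 : finType) (C : A1 + A2 -> B1 + B2 -> \bar R) :
  #|A1| = #|B1| -> #|A2| = #|B2| ->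
  (forall a b, C (inl a) (inr b) = -oo) ->
  tper C = tper (fun a b => C (inl a) (inl b)) +
           tper (fun a b => C (inr a) (inr b)).
Proof.
move=> AB1 AB2 C0; apply/le_anti/andP; split.
  apply: tper_le => f f_inj.
  have [[a [b fa]]|nof] := pselect (exists a b, f (inl a) = inr b).
    by rewrite (@sume_eqNy _ _ (inl a)) ?leNye // fa C0.
  have /choice[f1 f1E] : forall a, exists b, f (inl a) = inl b.
    move=> a; case fa: (f (inl a)) => [b|b]; first by exists b.
    by case: nof; exists a, b.
  have f1_inj : injective f1.
    by move=> x y xy; apply: (@inl_inj A1 A2); apply: f_inj; rewrite !f1E xy.
  have [f1' f1K f1'K] := inj_card_bij f1_inj (eq_leq (esym AB1)).
  have /choice[f2 f2E] : forall a, exists b, f (inr a) = inr b.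
    move=> a; case fa: (f (inr a)) => [b|b]; last by exists b.
    by have := f1E (f1' b); rewrite f1'K -fa => /f_inj.
  have f2_inj : injective f2.
    by move=> x y xy; apply: (@inr_inj A1 A2); apply: f_inj; rewrite !f2E xy.
  rewrite big_sumType /=; apply: leeD.
    rewrite (eq_bigr (fun a => C (inl a) (inl (f1 a)))); last first.
      by move=> a _; rewrite f1E.
    exact: (tper_ge (fun a b => C (inl a) (inl b))).
  rewrite (eq_bigr (fun a => C (inr a) (inr (f2 a)))); last first.
    by move=> a _; rewrite f2E.
  exact: (tper_ge (fun a b => C (inr a) (inr b))).
have [f1 f1_inj ->] := tper_attained (fun a b => C (inl a) (inl b)) AB1.
have [f2 f2_inj ->] := tper_attained (fun a b => C (inr a) (inr b)) AB2.
pose f (a : A1 + A2) : B1 + B2 :=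
  match a with inl x => inl (f1 x) | inr x => inr (f2 x) end.
have f_inj : injective f.
  by move=> [x|x] [y|y] //= []; [move/f1_inj->|move/f2_inj->].
by apply: le_trans (tper_ge C f_inj); rewrite big_sumType.
Qed.

(* Exchange along an alternating path: [g] and [h] are swapped on the rows met
   by following [s := h \o g^-1] from [p] up to its first return [q] to [D]. *)
Lemma tper_exchange (V : finType) (C1 C2 : V -> V -> \bar R) (D : {set V})
    (p : V) :
  p \in D -> (forall v u, u \notin D -> C1 v u = C2 v u) ->
  exists2 q, q \in D &
    tper C1 + tper C2 <=
      tper (fun v u => if u == p then C2 v q else C1 v u) +
      tper (fun v u => if u == q then C1 v p else C2 v u).
Proof.
move=> pD C12.
have [g0 g0_inj ->] := tper_attained C1 erefl.
have [h0 h0_inj ->] := tper_attained C2 erefl.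
pose g := perm g0_inj; pose h := perm h0_inj.
pose s : {perm V} := (g^-1 * h)%g.
have sg v : s (g v) = h v by rewrite /s permM permK.
(* [s] has finite order, so the orbit of [p] comes back at least to [p], which lies in [D]. *)
have ex_ret : exists k, (s ^+ k.+1)%g p \in D.
  by exists #[s]%g.-1; rewrite prednK ?order_gt0 // expg_order perm1.
have [k kD kmin] := ex_minnP ex_ret.
set q := (s ^+ k.+1)%g p in kD; exists q => //.
(* The segment from [p] to [s^k p] meets [D] only in [p], since [k] is the least return time. As [t]
   sends the exit point [q] back to [p], the segment is stable under [t \o s]. *)
pose t := tperm p q.
pose Z : {set V} := (fun i : 'I_k.+1 => (s ^+ i)%g p) @: 'I_k.+1.
have ZP u : reflect (exists2 i, (i <= k)%N & u = (s ^+ i)%g p) (u \in Z).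
  apply: (iffP imsetP) => [[i _ ->]|[i ik ->]].
    by exists i => //; rewrite -ltnS.
  by exists (Ordinal (ik : (i < k.+1)%N)).
have pZ : p \in Z by apply/ZP; exists 0%N; rewrite // expg0 perm1.
have ZD u : u \in Z -> u != p -> u \notin D.
  move=> /ZP[[|i] ik ->]; first by rewrite expg0 perm1 eqxx.
  by move=> _; apply/negP => /kmin; rewrite leqNgt ik.
have Zs u : u \in Z -> s u = q \/ (s u \in Z /\ s u \notin D).
  move=> /ZP[i ik ->]; rewrite -permM -expgSr.
  have [->|ik'] := eqVneq i k; first by left.
  have {ik ik'}ik : (i < k)%N by rewrite ltn_neqAle ik' ik.
  right; split; first by apply/ZP; exists i.+1.
  by apply/negP => /kmin; rewrite leqNgt ik.
have t_id u : u \notin D -> t u = u.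
  by move=> uD; rewrite /t tpermD //; apply: contraNneq uD => <-.
have tsZ u : (t (s u) \in Z) = (u \in Z).
  have sub : (fun u => t (s u)) @: Z \subset Z.
    apply/fintype.subsetP => _ /imsetP[v vZ ->].
    by have [->|[sZ sD]] := Zs _ vZ; [rewrite /t tpermR | rewrite t_id].
  have ts_inj : injective (fun u => t (s u)) by move=> x y /perm_inj/perm_inj.
  have /eqP ZE : (fun u => t (s u)) @: Z == Z.
    by rewrite eqEcard sub card_imset //= leqnn.
  by rewrite -{1}ZE mem_imset.
(* The rows that [g] sends into [Z] exchange their columns, and [t] interchanges [p] and [q] at the
   two ends of the segment. *)
pose g' v := if g v \in Z then t (h v) else g v.
pose h' v := if g v \in Z then t (g v) else h v.
have g'_inj : injective g'.
  move=> x y; rewrite /g' -!sg.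
  case: ifPn => xZ; case: ifPn => yZ e.
  - by move: e => /perm_inj/perm_inj/perm_inj.
  - by move: yZ; rewrite -e tsZ xZ.
  - by move: xZ; rewrite e tsZ yZ.
  - by move: e => /perm_inj.
have h'_inj : injective h'.
  have tK : involutive t by apply: tpermK.
  move=> x y; rewrite /h' -!sg.
  case: ifPn => xZ; case: ifPn => yZ e.
  - by move: e => /perm_inj/perm_inj.
  - by move: yZ; rewrite -tsZ -e tK xZ.
  - by move: xZ; rewrite -tsZ e tK yZ.
  - by move: e => /perm_inj/perm_inj.
apply: le_trans (leeD (tper_ge _ g'_inj) (tper_ge _ h'_inj)).
rewrite -!big_split /=; apply: lee_sum => v _.
rewrite -[g0 v](permE g0_inj) -[h0 v](permE h0_inj) -/g -/h /g' /h'.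
case: (boolP (g v \in Z)) => vZ; last first.
  rewrite (_ : g v == p = false); last by apply: contraNF vZ => /eqP->.
  rewrite (_ : h v == q = false) //; apply: contraNF vZ => /eqP vq.
  by rewrite -tsZ sg vq /t tpermR.
(* On an exchanged row, a column outside [D] has the same entry in both matrices. The remaining
   ones, [q] for [h] and [p] for [g], become the two modified columns. *)
rewrite addeC; apply: leeD.
  have := Zs _ vZ; rewrite sg => -[->|[_ sD]].
    by rewrite /t tpermR eqxx.
  rewrite t_id // -C12 //; case: eqP => // e.
  by rewrite e pD in sD.
have [->|vp] := eqVneq (g v) p; first by rewrite /t tpermL eqxx.
rewrite t_id ?ZD // C12 ?ZD //; case: eqP => // e.
by have := ZD _ vZ vp; rewrite e kD.
Qed.

Lemma tper_perm (A B : finType) (C : A -> B -> \bar R) (s : {perm B}) :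
  tper (fun a b => C a (s b)) = tper C.
Proof.
rewrite (@tper_reindex A B A B id s C) //; first exact: inv_bij.
by exists (s^-1)%g => x; rewrite (permK, permKV).
Qed.

Lemma tper0 (A : finType) (C : A -> A -> \bar R) : (forall a, C a a = 0) ->
  (forall f : A -> A, injective f -> \sum_a C a (f a) <= 0) -> tper C = 0.
Proof.
move=> C0 H; apply/le_anti/andP; split; first exact: tper_le.
by apply: le_trans (tper_ge C (f := id) (fun _ _ => id)); rewrite big1.
Qed.

End TropicalPermanent.

(** * Path families as permutations *)

Section Layered.
Variable R : realType.

(** Strictly increasing heights exclude oriented cycles, and they are easily stacked under
    concatenation. *)
Record layered (n : nat) (N : network n) (r : R) (ht : vertex N -> R) := {
  ly_gt0 : 0 < r;
  ly_ge0 : forall v, 0 <= ht v;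
  ly_ler : forall v, ht v <= r;
  ly_edge : forall e : edge N, ht (src e) < ht (tgt e);
  ly_source : forall i, ht (source i) = 0;
  ly_sink : forall i, ht (sink i) = r;
  ly_source_inj : injective (@source n N);
  ly_sink_inj : injective (@sink n N) }.

Lemma planar_layered (n : nat) (N : network n) (E : planar_embedding R N) :
  layered (width E) (@xcoord R n N E).
Proof.
have ord_inj (f : 'I_n -> vertex N) :
    (forall i j : 'I_n, (i < j)%N -> ycoord E (f i) < ycoord E (f j)) ->
    injective f.
  move=> f_lt i j fij; case: (ltngtP i j) => [ij|ij|/val_inj//].
    by have := f_lt _ _ ij; rewrite fij ltxx.
  by have := f_lt _ _ ij; rewrite fij ltxx.
split.
- exact: width_gt0.
- by move=> v; case/andP: (strip E v).
- by move=> v; case/andP: (strip E v).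
- exact: left_to_right.
- exact: source_left.
- exact: sink_right.
- apply: ord_inj; exact: source_bottom_to_top.
- apply: ord_inj; exact: sink_bottom_to_top.
Qed.

Section Theory.
Variables (n : nat) (N : network n) (r : R) (ht : vertex N -> R).
Hypothesis lyN : layered r ht.

Lemma tgt_neq_source (e : edge N) i : tgt e != source i.
Proof.
apply: contraTneq (ly_edge lyN e) => ->.
by rewrite (ly_source lyN) -leNgt (ly_ge0 lyN).
Qed.

Lemma source_neq_sink i j : source i != sink j :> vertex N.
Proof.
apply/eqP => /(congr1 ht); rewrite (ly_source lyN) (ly_sink lyN) => r0.
by have := ly_gt0 lyN; rewrite -r0 ltxx.
Qed.

(** Both [glue] and the columns of [path_matrix] are computed along this case distinction. *)
Lemma codom_sourceP (v : vertex N) :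
  (exists i, v = source i) \/ (exists u : nonsource N, v = val u).
Proof.
case: (boolP (v \in codom (@source n N))) => [/codomP[i ->]|vN].
  by left; exists i.
by right; exists (exist _ v vN).
Qed.

Lemma nonsource_neq (u : nonsource N) i : source i != val u.
Proof. by apply: contraNneq (valP u) => <-; apply: codom_f. Qed.

End Theory.

Section Matrix.
Local Open Scope ereal_scope.
Variables (n : nat) (N : network n) (w : edge N -> \bar R)
  (t : 'I_n -> pred (vertex N)).

(** The weighted adjacency matrix over the max-plus semiring: parallel edges compete, and a missing
    edge counts as [-oo]. *)
Definition link (v u : vertex N) : \bar R :=
  \big[maxe/-oo]_(e : edge N | (src e == v) && (tgt e == u)) w e.

(* A family of n disjoint paths, one from each source, is encoded by the
   permutation of the vertices sending each visited vertex to the next one on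
   its path, the last vertex of a path to some source, and fixing the other
   vertices. Entry (v, source i) thus tells whether a path may end at v, the
   terminals allowed to the i-th path being those of [t i]. *)
Definition path_matrix (v u : vertex N) : \bar R :=
  if [pick i | source i == u] is Some i then if t i v then 0 else -oo
  else if u == v then 0 else link v u.

Definition per : \bar R := tper path_matrix.

Lemma path_matrix_nonsource v u : u \notin codom (@source n N) ->
  path_matrix v u = if u == v then 0 else link v u.
Proof.
rewrite /path_matrix; case: pickP => // i /eqP <-.
by rewrite codom_f.
Qed.

Lemma path_matrix_source (r : R) (ht : vertex N -> R) v i :
  layered r ht ->
  path_matrix v (source i) = if t i v then 0 else -oo.
Proof.
move=> lyN; rewrite /path_matrix; case: pickP.
  by move=> j /eqP/(ly_source_inj lyN)->.
by move/(_ i); rewrite eqxx.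
Qed.

Lemma link_eqNy v u :
  (forall e, src e = v -> tgt e = u -> False) -> link v u = -oo.
Proof.
move=> h; apply: big_pred0 => e.
by apply/negP => /andP[/eqP ? /eqP ?]; apply: (h e).
Qed.

Lemma link_ge e : w e <= link (src e) (tgt e).
Proof.
apply: (@le_bigmax_cond _ _ _ _ e
  (fun e' => (src e' == src e) && (tgt e' == tgt e)) w).
by rewrite !eqxx.
Qed.

Lemma link_attained v u : link v u = -oo \/
  exists e, [/\ src e = v, tgt e = u & link v u = w e].
Proof.
have [[e /andP[sv tu]]|h] :=
  pselect (exists e : edge N, (src e == v) && (tgt e == u)).
  right; have [f /andP[/eqP fs /eqP ft] fE] := @eq_bigmax _ _ _ -oo e
    (fun e => (src e == v) && (tgt e == u)) w
    (introT andP (conj sv tu)) (fun f _ => leNye _).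
  by exists f; split.
left; apply: link_eqNy => e sv tu; apply: h; exists e.
by rewrite sv tu !eqxx.
Qed.

(** A permutation that follows links climbs strictly; this later excludes nontrivial cycles that
    avoid the sources. *)
Lemma link_height (r : R) (ht : vertex N -> R) v u : layered r ht ->
  link v u = -oo \/ (ht v < ht u)%R.
Proof.
move=> lyN; have [->|[e [<- <- _]]] := link_attained v u; first by left.
by right; apply: (ly_edge lyN).
Qed.

End Matrix.

Lemma eq_per (n : nat) (N : network n) (w : edge N -> \bar R)
    (t t' : 'I_n -> pred (vertex N)) :
  (forall i v, t i v = t' i v) -> per w t = per w t'.
Proof.
move=> tt'; apply: eq_tper => v u; rewrite /path_matrix.
by case: pickP => // i _; rewrite tt'.
Qed.

(** * Heights and adjacency matrix of a concatenation *)

Section Concat.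
Local Open Scope ereal_scope.
Variables (n : nat) (N1 N2 : network n) (r1 r2 : R)
  (ht1 : vertex N1 -> R) (ht2 : vertex N2 -> R).
Hypotheses (ly1 : layered r1 ht1) (ly2 : layered r2 ht2).

Lemma glue_source i : glue N1 (source i) = inl (sink i) :> _ + nonsource N2.
Proof.
rewrite /glue; case: {-}_ / boolP => [iP|/negP[]]; last exact: codom_f.
by congr (inl (sink _)); apply: (ly_source_inj ly2); rewrite f_iinv.
Qed.

Lemma glue_nonsource (u : nonsource N2) : glue N1 (val u) = inr u.
Proof.
rewrite /glue; case: {-}_ / boolP => [iP|uP].
  by have := valP u; rewrite iP.
by congr inr; apply: val_inj.
Qed.

Lemma glue_inj : injective (@glue n N1 N2).
Proof.
move=> x y.
have [[i ->]|[u ->]] := codom_sourceP x;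
have [[j ->]|[v ->]] := codom_sourceP y;
  rewrite ?glue_source ?glue_nonsource //.
  by move=> [/(ly_sink_inj ly1)->].
by move=> [->].
Qed.

(** The second network is lifted by [r1], so that the heights agree at the glued vertices. *)
Definition concat_height (v : vertex (concat N1 N2)) : R :=
  match v with inl v1 => ht1 v1 | inr v2 => (r1 + ht2 (val v2))%R end.

Lemma concat_height_glue v : concat_height (glue N1 v) = (r1 + ht2 v)%R.
Proof.
have [[i ->]|[u ->]] := codom_sourceP v; last by rewrite glue_nonsource.
by rewrite glue_source /= (ly_sink ly1) (ly_source ly2) addr0.
Qed.

Lemma layered_concat : layered (r1 + r2)%R concat_height.
Proof.
have r1_ge0 := ltW (ly_gt0 ly1); have r2_ge0 := ltW (ly_gt0 ly2).
split.
- by rewrite addr_gt0 ?(ly_gt0 ly1) ?(ly_gt0 ly2).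
- by move=> [v|v] /=; [exact: (ly_ge0 ly1)|rewrite addr_ge0 ?(ly_ge0 ly2)].
- move=> [v|v] /=; last by rewrite lerD2l (ly_ler ly2).
  by rewrite (le_trans (ly_ler ly1 v)) // lerDl.
- move=> [e|e]; first exact: (ly_edge ly1).
  by rewrite !concat_height_glue ltrD2l (ly_edge ly2).
- by move=> i; apply: (ly_source ly1).
- by move=> i; rewrite concat_height_glue (ly_sink ly2).
- by move=> i j [/(ly_source_inj ly1)].
- by move=> i j /glue_inj/(ly_sink_inj ly2).
Qed.

Variables (w1 : edge N1 -> \bar R) (w2 : edge N2 -> \bar R).
Notation w12 := (concat_weight w1 w2).

(** No edge enters a vertex of height zero, so edges of [N2] never end at a glued vertex. *)
Lemma glue_tgt (e : edge N2) u : glue N1 (tgt e) != inl u.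
Proof.
have [[i ti]|[x ->]] := codom_sourceP (tgt e); last by rewrite glue_nonsource.
by have := tgt_neq_source ly2 e i; rewrite ti eqxx.
Qed.

Lemma link_concat_inl v u : link w12 (inl v) (inl u) = link w1 v u.
Proof.
rewrite /link big_sumType /= [X in maxe _ X]big_pred0 ?max_l ?leNye // => e.
by rewrite (negbTE (glue_tgt _ _)) andbF.
Qed.

Lemma link_concat_glue v (u : nonsource N2) :
  link w12 (glue N1 v) (inr u) = link w2 v (val u).
Proof.
rewrite /link big_sumType /= big_pred0 => [|e]; last by rewrite andbF.
rewrite max_r ?leNye //; apply: eq_bigl => e.
by rewrite -glue_nonsource !(inj_eq glue_inj).
Qed.

Lemma link_concat_inl_inr v u : v \notin codom (@sink n N1) ->
  link w12 (inl v) (inr u) = -oo.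
Proof.
move=> vN; apply: link_eqNy => -[e|e] //=.
have [[i ->]|[x ->]] := codom_sourceP (src e); last by rewrite glue_nonsource.
by rewrite glue_source => -[sv]; rewrite -sv codom_f in vN.
Qed.

Lemma link_concat_inr_inl v u : link w12 (inr v) (inl u) = -oo.
Proof.
by apply: link_eqNy => -[e|e] //= _ /eqP; apply/negP/glue_tgt.
Qed.

End Concat.
End Layered.

Local Open Scope ereal_scope.

(** * Block decompositions of permanents at a junction of networks *)

Section SinkTerminals.
Variable R : realType.

Definition sinks (n : nat) (N : network n) (i : 'I_n) : pred (vertex N) :=
  [in codom (@sink n N)].

(** The height differences are nonnegative and sum to zero, because [f] permutes [V]; hence they all
    vanish. *)
Lemma injective_increasing_id (V : finType) (ht : V -> R) (f : V -> V) :
  injective f -> (forall v, f v != v -> (ht v < ht (f v))%R) -> f =1 id.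
Proof.
move=> f_inj f_up.
have le v : (0 <= ht (f v) - ht v)%R.
  rewrite subr_ge0; case: (eqVneq (f v) v) => [->//|/f_up/ltW//].
have s0 : (\sum_v (ht (f v) - ht v) = 0)%R.
  by rewrite sumrB [X in (_ - X)%R](reindex_inj f_inj) subrr.
move=> v; apply/eqP; apply: contraT => /f_up.
have e : (ht (f v) - ht v = 0)%R := psumr_eq0P (fun u _ => le u) s0 isT.
by rewrite -subr_gt0 e ltxx.
Qed.

(** Splits the vertices into the image of [s] and its complement. Taken at the sinks for rows and at
    the sources for columns, it displays the block structure. *)
Definition extend (n : nat) (V : finType) (s : 'I_n -> V)
  (a : {v : V | v \notin codom s} + 'I_n) : V :=
  match a with inl v => val v | inr i => s i end.

Lemma extend_bij (n : nat) (V : finType) (s : 'I_n -> V) :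
  injective s -> bijective (extend (s := s)).
Proof.
move=> s_inj.
have e_inj : injective (extend (s := s)).
  move=> [[x xP]|i] [[y yP]|j] //=.
  - by move=> xy; congr inl; apply: val_inj.
  - by move=> xy; exfalso; move/negP: xP; apply; rewrite xy codom_f.
  - by move=> xy; exfalso; move/negP: yP; apply; rewrite -xy codom_f.
  - by move=> /s_inj->.
apply: (inj_card_bij e_inj).
rewrite card_sum card_sig card_ord -[n in (_ + n)%N]card_ord.
by rewrite -(card_codom s_inj) addnC -(cardC (mem (codom s))).
Qed.

Section PerSinks.
Variables (n : nat) (N : network n) (r : R) (ht : vertex N -> R).
Hypothesis lyN : layered r ht.
Variable w : edge N -> \bar R.

Lemma card_nonsink :
  #|{: {v : vertex N | v \notin codom (@sink n N)}}| = #|{: nonsource N}|.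
Proof.
have := bij_eq_card (extend_bij (ly_source_inj lyN)).
have := bij_eq_card (extend_bij (ly_sink_inj lyN)).
by rewrite !card_sum => <- /eqP; rewrite eqn_add2r => /eqP.
Qed.

(** A nonsink has [-oo] in every source column, so the matrix is block triangular. The block of
    sinks against sources is identically 0. *)
Lemma per_sinks :
  per w (@sinks n N) =
  tper (fun (v : {v : vertex N | v \notin codom (@sink n N)})
            (u : nonsource N) =>
          if val u == val v then 0 else link w (val v) (val u)).
Proof.
rewrite /per (tper_reindex _ (extend_bij (ly_sink_inj lyN))
  (extend_bij (ly_source_inj lyN))) tper_block ?card_nonsink //; last first.
  move=> v i /=; rewrite (path_matrix_source _ _ _ _ lyN) /sinks.
  by rewrite (negbTE (valP v)).
rewrite [X in _ + X]tper0 ?adde0.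
- by apply: eq_tper => v u /=; rewrite path_matrix_nonsource ?(valP u).
- by move=> i /=; rewrite (path_matrix_source _ _ _ _ lyN) /sinks /= codom_f.
- move=> f _; apply: sume_le0 => i _ /=.
  by rewrite (path_matrix_source _ _ _ _ lyN); case: ifP => // _; exact: leNye.
Qed.

End PerSinks.

Section Concat.
Variables (n : nat) (N1 N2 : network n) (r1 r2 : R)
  (ht1 : vertex N1 -> R) (ht2 : vertex N2 -> R).
Hypotheses (ly1 : layered r1 ht1) (ly2 : layered r2 ht2).
Variables (w1 : edge N1 -> \bar R) (w2 : edge N2 -> \bar R).
Variable t : 'I_n -> pred (vertex (concat N1 N2)).
Notation w12 := (concat_weight w1 w2).

Lemma inl_nonsource v : v \notin codom (@source n N1) ->
  inl v \notin codom (@source n (concat N1 N2)).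
Proof. by apply: contraNN => /codomP[i [->]]; apply: codom_f. Qed.

Lemma inr_nonsource u : inr u \notin codom (@source n (concat N1 N2)).
Proof. by apply/negP => /codomP[]. Qed.

Lemma path_matrix_concat_inl v u :
  path_matrix w12 t (inl v) (inl u) =
  path_matrix w1 (fun i v => t i (inl v)) v u.
Proof.
have [[i ->]|[x ->]] := codom_sourceP u.
  rewrite (path_matrix_source _ _ _ _ ly1).
  exact: (path_matrix_source _ _ _ _ (layered_concat ly1 ly2)).
rewrite !path_matrix_nonsource ?inl_nonsource ?(valP x) //.
by rewrite (link_concat_inl ly2).
Qed.

Lemma path_matrix_concat_glue v (u : nonsource N2) :
  path_matrix w12 t (glue N1 v) (inr u) =
  if val u == v then 0 else link w2 v (val u).
Proof.
rewrite path_matrix_nonsource ?inr_nonsource // (link_concat_glue ly1 ly2).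
by rewrite -(glue_nonsource N1 u) (inj_eq (glue_inj ly1 ly2)).
Qed.

(** No edge leads back from [N2] and no terminal lies beyond [N1], so the matrix is block
    triangular. In the block of [N2], a permutation avoiding [-oo] climbs at every vertex it moves,
    hence is the identity, of weight 0. *)
Lemma per_concat_left :
  (forall i u, t i (inr u) = false) ->
  per w12 t = per w1 (fun i v => t i (inl v)).
Proof.
move=> tF.
pose swap (x : nonsource N2 + vertex N1) : vertex (concat N1 N2) :=
  match x with inl a => inr a | inr b => inl b end.
have swap_bij : bijective swap.
  by exists (fun x : vertex (concat N1 N2) =>
    match x with inl a => inr a | inr b => inl b end) => -[].
rewrite /per (@tper_reindex R _ _ _ _ _ _ _ swap_bij swap_bij).
rewrite (@tper_block R (nonsource N2) (vertex N1)
  (nonsource N2) (vertex N1)) //=.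
- rewrite tper0 ?add0e.
  + by apply: eq_tper => v u; rewrite path_matrix_concat_inl.
  + by move=> a; rewrite -{1}glue_nonsource path_matrix_concat_glue eqxx.
  + move=> f f_inj.
    have [[a fa]|nof] := pselect (exists a,
        path_matrix w12 t (inr a) (inr (f a)) = -oo).
      by rewrite (@sume_eqNy _ _ _ a) ?leNye.
    rewrite big1 // => a _.
    rewrite (@injective_increasing_id _ (fun a => ht2 (val a)) f) //.
      by rewrite -{1}glue_nonsource path_matrix_concat_glue eqxx.
    move=> b fb.
    have [fbN|//] := link_height w2 (val b) (val (f b)) ly2.
    case: nof; exists b.
    by rewrite -{1}glue_nonsource path_matrix_concat_glue (inj_eq val_inj)
      (negbTE fb).
- move=> v u; have [[i ->]|[x ->]] := codom_sourceP u.
    have /= -> := path_matrix_source w12 t (inr v) i (layered_concat ly1 ly2).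
    by rewrite tF.
  by rewrite path_matrix_nonsource ?inl_nonsource ?(valP x) //=
    (link_concat_inr_inl ly2).
Qed.

(** All paths cross the glued vertices, so the weight splits into that of [n] paths through [N1] and
    that of a family in [N2]. *)
Lemma per_concat_right :
  (forall i v, v \notin codom (@sink n N1) -> t i (inl v) = false) ->
  per w12 t = per w1 (@sinks n N1) + per w2 (fun i v => t i (glue N1 v)).
Proof.
move=> tF.
(* The junction is cut differently for rows and columns: a glued vertex is a row of [N2] but a
   column of [N1]. The source columns of [N2] are represented by the source columns of the
   concatenation, which carry the terminals. *)
pose phi (x : {v : vertex N1 | v \notin codom (@sink n N1)} + vertex N2) :
    vertex (concat N1 N2) :=
  match x with inl v => inl (val v) | inr v => glue N1 v end.
pose psi (x : nonsource N1 + vertex N2) : vertex (concat N1 N2) :=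
  match x with inl v => inl (val v)
  | inr v => if [pick i | source i == v] is Some i then inl (source i)
             else glue N1 v end.
have psi_source i : psi (inr (source i)) = inl (source i).
  rewrite /psi; case: pickP => [j /eqP/(ly_source_inj ly2)->//|/(_ i)].
  by rewrite eqxx.
have psi_nonsource (u : nonsource N2) : psi (inr (val u)) = inr u.
  rewrite /psi; case: pickP => [j /eqP e|_]; last exact: glue_nonsource.
  by have := nonsource_neq u j; rewrite e eqxx.
have phi_bij : bijective phi.
  have phi_inj : injective phi.
    have E (v : {v : vertex N1 | v \notin codom (@sink n N1)}) (w : vertex N2) :
        inl (val v) <> glue N1 w.
      have [[i ->]|[u ->]] := codom_sourceP w; last by rewrite glue_nonsource.
      rewrite (glue_source N1 ly2) => -[e]; have /= := svalP v.
      by rewrite e codom_f.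
    move=> [v|v] [w|w] /=.
    - by move=> [] /val_inj->.
    - by move/E.
    - by move/esym/E.
    - by move/(glue_inj ly1 ly2)->.
  apply: (inj_card_bij phi_inj).
  rewrite !card_sum (card_nonsink ly1).
  have := bij_eq_card (extend_bij (ly_source_inj ly1)).
  have := bij_eq_card (extend_bij (ly_source_inj ly2)).
  by rewrite !card_sum !card_ord => <- <-; rewrite addnA addnAC.
have psi_bij : bijective psi.
  have psi_inj : injective psi.
    move=> [v|v] [w|w].
    - by move=> [] /val_inj->.
    - have [[i ->]|[u ->]] := codom_sourceP w; last by rewrite psi_nonsource.
      rewrite psi_source => -[e].
      by have := nonsource_neq v i; rewrite -e eqxx.
    - have [[i ->]|[u ->]] := codom_sourceP v; last by rewrite psi_nonsource.
      rewrite psi_source => -[e].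
      by have := nonsource_neq w i; rewrite e eqxx.
    - have [[i ->]|[u ->]] := codom_sourceP v;
      have [[j ->]|[x ->]] := codom_sourceP w;
        rewrite ?psi_source ?psi_nonsource //.
      + by move=> [] /(ly_source_inj ly1)->.
      + by move=> [] ->.
  apply: (inj_card_bij psi_inj); rewrite -(bij_eq_card phi_bij).
  by rewrite !card_sum (card_nonsink ly1).
rewrite [in LHS]/per (@tper_reindex R _ _ _ _ _ _ _ phi_bij psi_bij).
rewrite (@tper_block R _ _ (nonsource N1) (vertex N2)) ?(card_nonsink ly1) //.
- rewrite (per_sinks ly1); congr (_ + _); apply: eq_tper => v u.
    rewrite path_matrix_concat_inl path_matrix_nonsource ?(valP u) //.
  have [[i ->]|[x ->]] := codom_sourceP u.
    rewrite psi_source (path_matrix_source _ _ _ _ ly2).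
    by rewrite (path_matrix_source _ _ _ _ (layered_concat ly1 ly2)).
  rewrite psi_nonsource path_matrix_concat_glue.
  by rewrite path_matrix_nonsource ?(valP x).
- move=> v u; have [[i ->]|[x ->]] := codom_sourceP u.
    rewrite psi_source (path_matrix_source _ _ _ _ (layered_concat ly1 ly2)).
    by rewrite tF ?(valP v).
  rewrite psi_nonsource path_matrix_nonsource ?inr_nonsource //=.
  by rewrite (link_concat_inl_inr ly2) ?(valP v).
Qed.

End Concat.
End SinkTerminals.

(** * Associativity of concatenation, as a bijection between vertices *)

Section Assoc.
Variables (R : realType) (n : nat) (N1 N2 N3 : network n) (r1 r2 r3 : R)
  (ht1 : vertex N1 -> R) (ht2 : vertex N2 -> R) (ht3 : vertex N3 -> R).
Hypotheses (ly1 : layered r1 ht1) (ly2 : layered r2 ht2) (ly3 : layered r3 ht3).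
Variables (w1 : edge N1 -> \bar R) (w2 : edge N2 -> \bar R)
  (w3 : edge N3 -> \bar R).
Notation N12 := (concat N1 N2).
Notation N23 := (concat N2 N3).

Let ly12 := layered_concat ly1 ly2.
Let ly23 := layered_concat ly2 ly3.

Definition inr_assoc (v : vertex N23) : vertex (concat N12 N3) :=
  match v with inl v2 => inl (glue N1 v2) | inr u3 => inr u3 end.

Definition assoc (v : vertex (concat N1 N23)) : vertex (concat N12 N3) :=
  match v with inl v1 => inl (inl v1) | inr u => inr_assoc (val u) end.

Lemma assoc_glue v : assoc (glue N1 v) = inr_assoc v.
Proof.
have [[i ->]|[u ->]] := codom_sourceP v; last by rewrite glue_nonsource.
by rewrite (glue_source N1 ly23) /= (glue_source N1 ly2).
Qed.

Lemma inr_assoc_glue v : inr_assoc (glue N2 v) = glue N12 v.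
Proof.
have [[i ->]|[u ->]] := codom_sourceP v; last by rewrite !glue_nonsource.
by rewrite !(glue_source _ ly3).
Qed.

Lemma inr_assoc_inj : injective inr_assoc.
Proof. by move=> [v|v] [u|u] //= [] => [/(glue_inj ly1 ly2)|] ->. Qed.

Lemma assoc_inj : injective assoc.
Proof.
(* A clash would put [u] at a source of [N2], which is also a source of [N23]. *)
have E (v : vertex N1) (u : nonsource N23) : assoc (inl v) <> assoc (inr u).
  move=> /=; case uE: (val u) => [x|x] //= [].
  have [[i xi]|[y ->]] := codom_sourceP x; last by rewrite glue_nonsource.
  move=> _; have := valP u; rewrite uE xi.
  by rewrite -[inl (source i)]/(source i : vertex N23) codom_f.
move=> [v|v] [u|u].
- by move=> [->].
- by move/E.
- by move/esym/E.
- by move=> /inr_assoc_inj/val_inj->.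
Qed.

(** Injectivity and a count of vertices, each gluing removing [n] of them. *)
Lemma assoc_bij : bijective assoc.
Proof.
apply: (inj_card_bij assoc_inj).
have := bij_eq_card (extend_bij (ly_source_inj ly2)).
have := bij_eq_card (extend_bij (ly_source_inj ly23)).
rewrite !card_sum !card_ord => e23 e2.
by rewrite -(leq_add2r n) -[leqRHS]addnA e23 -e2 !addnA (addnAC _ n).
Qed.

Lemma link_assoc v u :
  link (concat_weight (concat_weight w1 w2) w3) (assoc v) (assoc u) =
  link (concat_weight w1 (concat_weight w2 w3)) v u.
Proof.
rewrite /link !big_sumType /= maxA.
congr (maxe (maxe _ _) _); apply: eq_bigl => e.
- by rewrite -![inl (inl _)]/(assoc (inl _)) !(inj_eq assoc_inj).
- rewrite -![inl (glue N1 _)]/(inr_assoc (inl _)) -!assoc_glue.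
  by rewrite !(inj_eq assoc_inj).
- by rewrite -!inr_assoc_glue -!assoc_glue !(inj_eq assoc_inj).
Qed.

Lemma per_concat_assoc (t : 'I_n -> pred (vertex (concat N12 N3))) :
  per (concat_weight (concat_weight w1 w2) w3) t =
  per (concat_weight w1 (concat_weight w2 w3)) (fun i v => t i (assoc v)).
Proof.
rewrite /per (tper_reindex _ assoc_bij assoc_bij); apply: eq_tper => v u.
have [[i ->]|[x ->]] := codom_sourceP u.
  rewrite (path_matrix_source _ _ _ _ (layered_concat ly1 ly23)).
  exact: (path_matrix_source _ _ _ _ (layered_concat ly12 ly3)).
rewrite !path_matrix_nonsource ?(valP x) //.
  by rewrite link_assoc (inj_eq assoc_inj).
apply/negP => /codomP[i e]; have := nonsource_neq x i.
by rewrite (assoc_inj (e : _ = assoc (source i))) eqxx.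
Qed.

End Assoc.

(** * Maximal weights as tropical permanents *)

Section Labels.
Variables (R : realType) (n : nat) (N : network n) (r : R) (ht : vertex N -> R).
Hypothesis lyN : layered r ht.
Variable w : edge N -> \bar R.

(** Relabelling the terminals permutes the source columns, which leaves a permanent unchanged. *)
Lemma per_perm (t : 'I_n -> pred (vertex N)) (s : {perm 'I_n}) :
  per w (fun i => t (s i)) = per w t.
Proof.
pose f (v : vertex N) : vertex N :=
  if [pick i | source i == v] is Some i then source (s i) else v.
have f_source i : f (source i) = source (s i).
  rewrite /f; case: pickP => [j /eqP/(ly_source_inj lyN)->//|/(_ i)].
  by rewrite eqxx.
have f_id (u : nonsource N) : f (val u) = val u.
  rewrite /f; case: pickP => // j /eqP e.
  by have := nonsource_neq u j; rewrite e eqxx.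
have f_inj : injective f.
  move=> x y.
  have [[i ->]|[u ->]] := codom_sourceP x;
  have [[j ->]|[v ->]] := codom_sourceP y;
    rewrite ?f_source ?f_id //.
  - by move/(ly_source_inj lyN)/perm_inj->.
  - by move/eqP; rewrite (negbTE (nonsource_neq v _)).
  - by move/esym/eqP; rewrite (negbTE (nonsource_neq u _)).
rewrite /per -(tper_perm (path_matrix w t) (perm f_inj)).
apply: eq_tper => v u; rewrite permE.
have [[i ->]|[x ->]] := codom_sourceP u.
  by rewrite f_source !(path_matrix_source _ _ _ _ lyN).
by rewrite f_id !path_matrix_nonsource ?(valP x).
Qed.

(** Only the multiset of terminal classes matters; this is what makes the permanent a function on
    the tetrahedron. *)
Lemma per_perm_eq (K : eqType) (T : K -> pred (vertex N)) x0 (s s' : seq K) :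
  size s = n -> perm_eq s s' ->
  per w (fun i => T (nth x0 s i)) = per w (fun i => T (nth x0 s' i)).
Proof.
move=> sn ss'; have s'n : size s' == n by rewrite -sn (perm_size ss').
have /tuple_permP[p sE] : perm_eq s (Tuple s'n) by [].
rewrite -(per_perm (fun i => T (nth x0 s' i)) p); apply: eq_per => i v.
by rewrite sE -(tnth_nth x0 _ i) tnth_mktuple (tnth_nth x0).
Qed.

End Labels.

Lemma perm_eq_bool (s : seq bool) :
  perm_eq s (nseq (count id s) true ++ nseq (count negb s) false).
Proof.
elim: s => //= -[] s IHs /=; first by rewrite perm_cons.
change (perm_eq (false :: s)
  (nseq (count id s) true ++ [:: false] ++ nseq (count negb s) false)).
by rewrite perm_sym perm_catCA perm_cons perm_sym.
Qed.

Lemma sum_disjoint_seqs (R : realType) (V : finType) (l : nat)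
    (p : 'I_l -> seq V) (F : V -> \bar R) :
  (forall a, uniq (p a)) ->
  (forall a b, a != b -> forall v, v \in p a -> v \notin p b) ->
  \sum_v F v =
  \sum_a \sum_(u <- p a) F u + \sum_(v | [forall a, v \notin p a]) F v.
Proof.
move=> p_uniq p_disj.
rewrite (bigID (fun v => v \in \bigcup_a [set u in p a])) /=; congr (_ + _).
  rewrite partition_disjoint_bigcup.
    apply: eq_bigr => a _; rewrite big_uniq //=; apply: eq_bigl => v.
    by rewrite inE.
  move=> a b /p_disj ab; rewrite -setI_eq0; apply/eqP/setP => v.
  by rewrite !inE; apply/negP => /andP[/ab/negP].
apply: eq_bigl => v; apply/negP/forallP => [h a|h /bigcupP[a _]].
  by apply/negP => va; apply: h; apply/bigcupP; exists a; rewrite ?inE.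
by rewrite inE; apply/negP.
Qed.

(** * From an l-path to a permutation *)

Section LowerBound.
Variables (R : realType) (n : nat) (N : network n) (r : R) (ht : vertex N -> R).
Hypothesis lyN : layered r ht.
Variable w : edge N -> \bar R.

Lemma chain_path (v : vertex N) (s : seq (edge N)) :
  chain v s -> path (fun x y => (ht x < ht y)%R) v (map tgt s).
Proof.
elim: s v => //= e s IHs v /andP[/eqP <- /IHs->].
by rewrite (ly_edge lyN).
Qed.

Lemma visited_uniq (q : walk N) : chain q.1 q.2 -> uniq (visited q).
Proof.
move=> /chain_path q_path.
apply: (sorted_uniq _ _ (q_path : sorted _ (visited q))).
  by move=> y x z; apply: lt_trans.
by move=> x; rewrite ltxx.
Qed.

(** [y0] closes the walk into a cycle; the additional entry at the last vertex only has to be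
    nonnegative. *)
Lemma sum_chain_le (F : vertex N -> vertex N -> \bar R) y0 v s :
  chain v s -> uniq (v :: map tgt s) ->
  (forall e, w e <= F (src e) (tgt e)) -> 0 <= F (last v (map tgt s)) y0 ->
  \sum_(e <- s) w e <=
  \sum_(u <- v :: map tgt s) F u (next_at u y0 v (map tgt s)).
Proof.
move=> + + wF; elim: s v => [|e s IHs] v /=.
  by move=> _ _ F0; rewrite big_nil big_seq1 eqxx.
move=> /andP[/eqP ev es] /andP[vN es_uniq] F0.
rewrite big_cons [leRHS]big_cons eqxx; apply: leeD; first by rewrite -ev.
apply: le_trans (IHs _ es es_uniq F0) _; rewrite big_seq [leRHS]big_seq.
apply: lee_sum => u us; case: eqP => // uv.
by rewrite uv in us; rewrite us in vN.
Qed.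


Definition start_or_end (b : bool) : pred (vertex N) :=
  if b then [in codom (@sink n N)] else [in codom (@source n N)].

(** The permutation rotates the visited vertices of each path and fixes all others. A path first
    carries the label of its own source; [per_perm_eq] then moves the used labels to the front. *)
Lemma lpath_weight_le (l : nat) (P : 'I_l -> walk N) : is_lpath P ->
  lpath_weight w P <=
  per w
    (fun i => start_or_end (nth true (nseq l true ++ nseq (n - l) false) i)).
Proof.
move=> [P_path P_disj].
have P_chain a : chain (P a).1 (P a).2 by case/and3P: (P_path a).
have P_uniq a := visited_uniq (P_chain a).
have head_in a : (P a).1 \in visited (P a) by rewrite inE eqxx.
have /choice[h hE] : forall a, exists i, (P a).1 = source i.
  by move=> a; case/and3P: (P_path a) => _ /codomP.
have disj_eq a b v : v \in visited (P a) -> v \in visited (P b) -> a = b.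
  move=> va vb; apply/eqP; apply: contraT => /P_disj/(_ _ va).
  by rewrite vb.
have h_inj : injective h.
  move=> a b ab; apply: (disj_eq _ _ (P a).1) => //.
  by rewrite hE ab -hE.
pose s := [seq i \in codom h | i <- enum 'I_n].
have s_size : size s = n by rewrite size_map size_enum_ord.
have s_count : count id s = l.
  rewrite count_map -sum1_count big_enum_cond /=.
  by rewrite (eq_bigl [in codom h]) // sum1_card (card_codom h_inj) card_ord.
have s_perm : perm_eq s (nseq l true ++ nseq (n - l) false).
  have := perm_eq_bool s; rewrite s_count.
  suff -> : count negb s = (n - l)%N by [].
  by rewrite -s_size -(count_predC id s) s_count addKn.
rewrite -(per_perm_eq lyN w start_or_end true s_size s_perm).
have sE (i : 'I_n) : nth true s i = (i \in codom h).
  by rewrite (nth_map i) ?size_enum_ord // nth_ord_enum.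
set t := fun _ => _; set M := path_matrix w t.
pose g v := if [pick a | v \in visited (P a)] is Some a
            then next (visited (P a)) v else v.
have g_in a v : v \in visited (P a) -> g v = next (visited (P a)) v.
  rewrite /g; case: pickP => [b vb va|/(_ a)->//].
  by rewrite (disj_eq _ _ _ va vb).
have g_out v : (forall a, v \notin visited (P a)) -> g v = v.
  by rewrite /g => vN; case: pickP => // a va; have := vN a; rewrite va.
have g_inj : injective g.
  have E x y a : x \in visited (P a) -> g x = g y -> x = y.
    move=> xa; rewrite (g_in a) // => e.
    have gya : g y \in visited (P a) by rewrite -e mem_next.
    have [[b yb]|yN] := pselect (exists b, y \in visited (P b)).
      have gyb : g y \in visited (P b) by rewrite (g_in b) // mem_next.
      rewrite -(disj_eq _ _ _ gya gyb) in yb.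
      by rewrite -(prev_next (P_uniq a) x) e (g_in a) // prev_next.
    exfalso; apply: (yN); exists a; move: gya; rewrite g_out // => b.
    by apply/negP => yb; apply: yN; exists b.
  move=> x y e.
  have [[a xa]|xN] := pselect (exists b, x \in visited (P b)).
    exact: (E _ _ _ xa e).
  have [[a ya]|yN] := pselect (exists b, y \in visited (P b)).
    exact/esym/(E _ _ _ ya).
  rewrite !g_out // in e => a; apply/negP => va; [apply: yN|apply: xN];
  by exists a.
apply: le_trans (tper_ge M g_inj).
rewrite (sum_disjoint_seqs _ P_uniq P_disj) [X in _ + X]big1 ?adde0.
  apply: lee_sum => a _.
  rewrite (eq_big_seq (fun u => M u (next (visited (P a)) u))); last first.
    by move=> u ua; rewrite (g_in a).
  apply: (sum_chain_le (y0 := (P a).1)) (P_chain a) (P_uniq a) _ _.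
    move=> e; rewrite /M path_matrix_nonsource.
      case: eqP => [te|_]; last exact: link_ge.
      by have := ly_edge lyN e; rewrite te ltxx.
    by apply/negP => /codomP[i /eqP]; rewrite (negbTE (tgt_neq_source lyN _ _)).
  rewrite hE /M (path_matrix_source _ _ _ _ lyN) /t sE codom_f /=.
  by case/and3P: (P_path a) => _ _; rewrite hE => ->.
(* An unvisited vertex contributes 0: a nonsource by the diagonal entry, a source because its label
   is [false]. *)
move=> v /forallP vN; rewrite g_out // /M.
have [[i vi]|[u ->]] := codom_sourceP v; last first.
  by rewrite path_matrix_nonsource ?(valP u) // eqxx.
rewrite vi (path_matrix_source _ _ _ _ lyN) /t sE.
case: (boolP (i \in codom h)) => [|_].
  by move=> /codomP[a ia]; have := vN a; rewrite vi ia -hE head_in.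
by rewrite /= codom_f.
Qed.

End LowerBound.

(** Walking back from [y] until [S] is met gives [x]. The last clause says that the segment from [x]
    absorbs every [v] that reaches [y] without meeting [S] in between. *)
Lemma first_return (V : finType) (g : V -> V) (S : pred V) (y : V) :
  injective g -> S y ->
  exists x k, [/\ S x, iter k.+1 g x = y,
    forall m, (0 < m <= k)%N -> ~~ S (iter m g x) &
    forall v j, iter j.+1 g v = y ->
      (forall m, (0 < m <= j)%N -> ~~ S (iter m g v)) ->
      v \in traject g x k.+1].
Proof.
move=> g_inj Sy; pose s : {perm V} := perm g_inj.
have iterE k v : iter k g v = (s ^+ k)%g v.
  by rewrite permX; apply: eq_iter => u; rewrite permE.
have ex_ret : exists k, S ((s ^- k.+1)%g y).
  exists #[s]%g.-1; rewrite prednK ?order_gt0 //.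
  by rewrite expg_order invg1 perm1.
have [k kS kmin] := ex_minnP ex_ret.
set x := (s ^- k.+1)%g y in kS.
have xE m : (m <= k.+1)%N -> iter m g x = (s ^- (k.+1 - m))%g y.
  move=> mk; rewrite iterE /x -permM; congr (fun_of_perm _ y).
  by rewrite -{1}(subnKC mk) expgD invMg -mulgA mulVg mulg1.
exists x, k; split => //.
- by rewrite xE // subnn expg0 invg1 perm1.
- move=> m /andP[m0 mk]; rewrite xE; last exact: leqW.
  apply/negP; rewrite subSn // => /kmin.
  by rewrite leqNgt ltn_subrL m0 (leq_trans m0 mk).
- move=> v j vy vS; have vE : v = (s ^- j.+1)%g y.
    by rewrite -vy iterE -permM mulgV perm1.
  have jk : (j <= k)%N.
    rewrite leqNgt; apply/negP => kj.
    have /vS/negP[] : (0 < j - k <= j)%N by rewrite subn_gt0 kj leq_subr.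
    suff -> : iter (j - k) g v = x by [].
    rewrite iterE vE /x -permM; congr (fun_of_perm _ y).
    rewrite -subSS -{1}(subnK (ltnW kj : (k.+1 <= j.+1)%N)) expgD invMg.
    by rewrite -mulgA mulVg mulg1.
  apply/trajectP; exists (k - j)%N; first by rewrite ltnS leq_subr.
  by rewrite xE ?subSn ?leq_subr ?subKn ?vE // leqW ?leq_subr.
Qed.

(** * From an optimal permutation back to an l-path *)

Section UpperBound.
Variables (R : realType) (n : nat) (N : network n) (r : R) (ht : vertex N -> R).
Hypothesis lyN : layered r ht.
Variable w : edge N -> \bar R.

Lemma walk_of_traject (g : vertex N -> vertex N) (k : nat) (x : vertex N) :
  (forall m, (m < k)%N -> link w (iter m g x) (iter m.+1 g x) != -oo) ->
  exists s, [/\ chain x s, map tgt s = traject g (g x) k &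
    \sum_(e <- s) w e = \sum_(u <- traject g x k) link w u (g u)].
Proof.
elim: k x => [|k IHk] x fin; first by exists [::]; rewrite !big_nil.
have [|s [s_chain s_tgt s_sum]] := IHk (g x).
  by move=> m mk; rewrite -!iterSr; apply: fin.
have /= := fin 0%N isT; have [->//|[e [ex eg eE]] _] := link_attained w x (g x).
exists (e :: s); split; first by rewrite /= ex eg eqxx.
  by rewrite /= eg s_tgt.
by rewrite /= !big_cons s_sum eE.
Qed.

(** The cycles of an optimal permutation are cut at the sources. The segments closing up through the
    first [l] labels are the required paths, and the vertices outside them contribute at most 0. *)
Lemma max_weight_ge (l : nat) : (l <= n)%N ->
  per w
    (fun i => start_or_end (nth true (nseq l true ++ nseq (n - l) false) i))
  <= max_weight w l.
Proof.
move=> ln; set t := fun _ => _.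
have tE (i : 'I_n) : t i = start_or_end (i < l)%N :> pred (vertex N).
  rewrite /t nth_cat size_nseq; case: ltnP => il; rewrite nth_nseq ?il //.
  by rewrite ltn_sub2r // (leq_ltn_trans il).
rewrite /per; have [g g_inj ->] := tper_attained (path_matrix w t) erefl.
set M := path_matrix w t.
have [[v vNy]|fin] := pselect (exists v, M v (g v) = -oo).
  by rewrite (@sume_eqNy _ _ _ v) ?leNye.
have {}fin v : M v (g v) != -oo by apply/eqP => e; apply: fin; exists v.
pose S : pred (vertex N) := [in codom (@source n N)].
have M_link v : ~~ S (g v) -> g v != v -> M v (g v) = link w v (g v).
  by move=> gS gv; rewrite /M path_matrix_nonsource // (negbTE gv).
have M_slot v i : g v = source i -> start_or_end (i < l)%N v /\ M v (g v) = 0.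
  move=> e; have := fin v; rewrite /M e (path_matrix_source _ _ _ _ lyN) tE.
  by case: ifP.
have iter_inj k : injective (iter k g).
  by elim: k => //= k IHk x y /g_inj/IHk.
(* The segment returning to the source [a] may start at another source [x a]: a label tells where a
   path closes up, not where it starts. *)
have ret (a : 'I_l) := first_return g_inj
  (codom_f (@source n N) (widen_ord ln a) : S _).
have /choice[x /choice[k ret2]] := ret.
pose T a := traject g (x a) (k a).+1.
have T_link a m : (m < k a)%N ->
    ~~ S (iter m.+1 g (x a)) /\ iter m.+1 g (x a) != iter m g (x a).
  move=> mk; have [Sx _ xN _] := ret2 a; split; first exact: xN.
  apply/eqP; rewrite iterSr => /iter_inj gx.
  by have := xN 1%N (leq_ltn_trans (leq0n m) mk); rewrite /= gx Sx.
have /choice[s sE] : forall a, exists s, [/\ chain (x a) s,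
    map tgt s = traject g (g (x a)) (k a) &
    \sum_(e <- s) w e = \sum_(u <- traject g (x a) (k a)) link w u (g u)].
  move=> a; apply: walk_of_traject => m /T_link[mS mE].
  by rewrite /= -M_link ?fin.
pose P a : walk N := (x a, s a).
have visitedE a : visited (P a) = T a.
  by rewrite /visited /=; have [_ -> _] := sE a.
(* The segment on which a common vertex comes earlier starts at a source lying on the other segment,
   hence at the first vertex of that one. Both then end at the same source. *)
have T_disj a b v : v \in T a -> v \in T b -> a = b.
  wlog : a b / exists j j', [/\ v = iter j g (x a), v = iter j' g (x b),
      (j <= k a)%N, (j' <= k b)%N & (j <= j')%N].
    move=> H va vb.
    have [/trajectP[j ja vj] /trajectP[j' jb vj']] := (va, vb).
    case: (leqP j j') => jj.
      by apply: H => //; exists j, j'.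
    by apply/esym; apply: H => //; exists j', j; split=> //; exact: ltnW.
  move=> [j [j' [vj vj' ja jb jj]]] _ _.
  have [Sa ya Na _] := ret2 a; have [Sb yb Nb _] := ret2 b.
  have xab : x a = iter (j' - j) g (x b).
    by apply: (iter_inj j); rewrite -iterD subnKC // -vj.
  have [jj0|jj0] := posnP (j' - j)%N; last first.
    have /Nb/negP[] : (0 < j' - j <= k b)%N.
      by rewrite jj0 (leq_trans (leq_subr _ _)).
    by rewrite -xab.
  rewrite jj0 /= in xab.
  have Sy c : S (iter (k c).+1 g (x c)).
    by have [_ -> _ _] := ret2 c; apply: codom_f.
  have kab : k a = k b.
    case: (ltngtP (k a) (k b)) => // kk.
      have /Nb/negP[] : (0 < (k a).+1 <= k b)%N by [].
      by rewrite -xab Sy.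
    have /Na/negP[] : (0 < (k b).+1 <= k a)%N by [].
    by rewrite xab Sy.
  apply/val_inj; move: ya; rewrite xab kab yb => /(ly_source_inj lyN).
  by move/(congr1 val).
have T_uniq a : uniq (T a).
  rewrite /T looping_uniq; apply/negP => /trajectP[j jk e].
  have [Sa _ Na _] := ret2 a.
  have xa : iter (k a - j) g (x a) = x a.
    by apply: (iter_inj j); rewrite -iterD subnKC // ltnW.
  have /Na/negP[] : (0 < k a - j <= k a)%N by rewrite subn_gt0 jk leq_subr.
  by rewrite xa.
have P_lpath : is_lpath P.
  split=> [a|a b ab v]; last first.
    rewrite !visitedE => va; apply/negP => /(T_disj _ _ _ va) e.
    by rewrite e eqxx in ab.
  have [s_chain s_tgt _] := sE a; have [Sa ya _ _] := ret2 a.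
  rewrite /source_sink_path /= s_chain s_tgt last_traject /=.
  apply/andP; split; first exact: Sa.
  by have [] := M_slot _ _ ya; rewrite /= ltn_ord.
apply: le_trans (ereal_sup_ubound _); last by exists P.
rewrite (sum_disjoint_seqs _ T_uniq); last first.
  move=> a b ab v va; apply/negP => /(T_disj _ _ _ va) e.
  by rewrite e eqxx in ab.
rewrite -[leRHS]adde0; apply: leeD.
  apply: lee_sum => a _; have [_ _ ->] := sE a; have [_ ya _ _] := ret2 a.
  rewrite /T trajectSr big_rcons /=; have [_ ->] := M_slot _ _ ya.
  rewrite adde0.
  rewrite big_seq [leRHS]big_seq; apply: lee_sum => u /trajectP[m mk ->].
  by have [mS mE] := T_link _ _ mk; rewrite M_link.
(* A vertex outside the segments contributes 0 if its image is a source or itself. Otherwise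
   climbing forces its orbit to reach a source, and the label of that source puts the vertex on a
   segment, a contradiction. *)
apply: sume_le0 => v /forallP vT.
have [[i gi]|[u gu]] := codom_sourceP (g v).
  by have [_ ->] := M_slot _ _ gi.
have gvS : ~~ S (g v) by rewrite gu; apply: (valP u).
have [gv|gv] := eqVneq (g v) v.
  by rewrite /M path_matrix_nonsource // gv eqxx.
have ex_ret : exists j, S (iter j.+1 g v).
  apply/not_existsP => vS.
  have up j : (ht v < ht (iter j.+1 g v))%R.
    elim: j => [|j IHj].
      have [e|//] := link_height w v (g v) lyN.
      by have := fin v; rewrite M_link // e.
    apply: lt_trans IHj _.
    set z := iter j.+1 g v.
    have gz : g z != z.
      by apply: contra_neq gv => gz; apply: (iter_inj j.+1); rewrite -iterSr.
    have [e|//] := link_height w z (g z) lyN.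
    by have := fin z; rewrite M_link ?e //; apply/negP/(vS j.+1).
  have := up (fingraph.order g v).-1.
  rewrite prednK ?fingraph.order_gt0 // iter_order //.
  by rewrite ltxx.
have [j jS jmin] := ex_minnP ex_ret.
have vN m : (0 < m <= j)%N -> ~~ S (iter m g v).
  case: m => // m /andP[_ mj]; apply/negP => /jmin.
  by rewrite leqNgt mj.
have /codomP[i yi] := jS.
(* A label at least [l] closes up at a source, but no vertex between [v] and its return is one. *)
have il : (i < l)%N.
  rewrite ltnNge; apply/negP => li.
  have [] := M_slot _ _ yi; rewrite ltnNge li /=.
  case: j jmin jS vN yi => [|j] jmin jS vN yi; first by rewrite jS in gvS.
  by have := vN j.+1; rewrite ltnS leqnn => /(_ isT)/negP.
have [_ _ _ cov] := ret2 (Ordinal il).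
have /negP[] := vT (Ordinal il); apply: cov vN.
by rewrite yi; congr source; apply: val_inj.
Qed.

Lemma max_weightE (l : nat) : (l <= n)%N -> max_weight w l =
  per w
    (fun i => start_or_end (nth true (nseq l true ++ nseq (n - l) false) i)).
Proof.
move=> ln; apply/le_anti/andP; split; last exact: max_weight_ge.
by apply: ge_ereal_sup => _ [P PP <-]; apply: (lpath_weight_le lyN).
Qed.

End UpperBound.

(** * The exchange relation for terminal classes *)

Section Exchange.
Variables (R : realType) (n : nat) (N : network n) (r : R) (ht : vertex N -> R).
Hypothesis lyN : layered r ht.
Variables (w : edge N -> \bar R) (K : Type) (T : K -> pred (vertex N)).

(** The class of a label only affects its source column, so exchanging columns amounts to trading
    classes. *)
Lemma per_exchange (k1 k2 : 'I_n -> K) (D : {set 'I_n}) (p : 'I_n) :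
  p \in D -> (forall i, i \notin D -> k1 i = k2 i) ->
  exists2 q, q \in D &
    per w (T \o k1) + per w (T \o k2) <=
    per w (fun i => T (if i == p then k2 q else k1 i)) +
    per w (fun i => T (if i == q then k1 p else k2 i)).
Proof.
move=> pD k12.
pose D' : {set vertex N} := (@source n N) @: D.
have [v u uD'|q'] := @tper_exchange R _ (path_matrix w (T \o k1))
    (path_matrix w (T \o k2)) D' (source p) (imset_f _ pD).
  have [[i ui]|[x ->]] := codom_sourceP u; last first.
    by rewrite !path_matrix_nonsource ?(valP x).
  rewrite ui !(path_matrix_source _ _ _ _ lyN) /= k12 //.
  by apply: contra uD' => iD; rewrite ui imset_f.
move=> /imsetP[q qD ->] le12; exists q => //; apply: le_trans le12 _.
have E (k k' : 'I_n -> K) (i j : 'I_n) v u :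
    (if u == source i then path_matrix w (T \o k') v (source j)
     else path_matrix w (T \o k) v u) =
    path_matrix w (fun h => T (if h == i then k' j else k h)) v u.
  have [[h ->]|[x ->]] := codom_sourceP u; last first.
    rewrite eq_sym (negbTE (nonsource_neq x i)).
    by rewrite !path_matrix_nonsource ?(valP x).
  rewrite (inj_eq (ly_source_inj lyN)) !(path_matrix_source _ _ _ _ lyN) /=.
  by case: eqP.
by apply: leeD; rewrite le_eqVlt; apply/orP; left; apply/eqP/eq_tper => v u;
  rewrite E.
Qed.

(** Starting from the constant class [c0], the labels receive their classes one at a time, each by
    an exchange with a constant assignment. *)
Lemma per_neqNy (c0 : K) (k : 'I_n -> K) :
  (forall c, per w (fun=> T c) != -oo) -> per w (T \o k) != -oo.
Proof.
move=> fin.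
have step h :
    per w (T \o (fun i : 'I_n => if (i < h)%N then k i else c0)) != -oo.
  elim: h => [|h IHh]; first exact: fin.
  have [hn|nh] := ltnP h n; last first.
    apply: contra_neq IHh => <-; apply: eq_per => i v /=.
    by rewrite leqW ?(leq_trans (ltn_ord i)).
  pose p := Ordinal hn.
  (* As the second assignment is constant, label [p] receives [k p] whatever [q] is. *)
  have [||q _ le12] := @per_exchange
    (fun i : 'I_n => if (i < h)%N then k i else c0) (fun=> k p)
    (finset predT) p.
  - by rewrite inE.
  - by move=> i; rewrite inE.
  apply: contraTneq le12 => e.
  rewrite [X in _ <= X + _](_ : _ = -oo) ?addNye ?leeNy_eq; last first.
    rewrite -e; apply: eq_per => i v /=.
    have [->|ip] := eqVneq i p; first by rewrite /= ltnSn.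
    by rewrite [in RHS]ltnS [in RHS]leq_eqVlt (negbTE (ip : i != h :> nat)).
  by rewrite adde_eq_ninfty negb_or IHh fin.
apply: contra_neq (step n) => <-; apply: eq_per => i v /=.
by rewrite ltn_ord.
Qed.

End Exchange.

(** * Reading off maximal weights *)

Section Boundary.
Variable R : realType.

Lemma mem_codom_inj (I : finType) (A B : eqType) (f : A -> B) (s : I -> A)
    (g : I -> B) (x : A) (y : B) :
  injective f -> (forall i, g i = f (s i)) -> y = f x ->
  (y \in codom g) = (x \in codom s).
Proof.
move=> f_inj gE ->; apply/codomP/codomP => -[i].
  by rewrite gE => /f_inj->; exists i.
by move=> ->; exists i; rewrite gE.
Qed.

Lemma nth_two_nseq (K : Type) (c0 c d : K) (n l : nat) (i : 'I_n) :
  nth c0 (nseq l c ++ nseq (n - l) d) i = if (i < l)%N then c else d.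
Proof.
rewrite nth_cat size_nseq; case: ltnP => il; rewrite nth_nseq ?il //.
by rewrite ltn_sub2r // (leq_ltn_trans il).
Qed.

Section OneNetwork.
Variables (n : nat) (N : network n) (r : R) (ht : vertex N -> R).
Hypothesis lyN : layered r ht.
Variable w : edge N -> \bar R.

Lemma per_start_or_end (K : Type) (T : K -> pred (vertex N)) (c0 c d : K) l :
  (l <= n)%N ->
  (forall v, T c v = (v \in codom (@sink n N))) ->
  (forall v, T d v = (v \in codom (@source n N))) ->
  per w (fun i => T (nth c0 (nseq l c ++ nseq (n - l) d) i)) = max_weight w l.
Proof.
move=> ln Tc Td; rewrite (max_weightE lyN) //; apply: eq_per => i v.
by rewrite !nth_two_nseq; case: ifP => _ /=.
Qed.

Lemma per_sinks_max : per w (@sinks n N) = max_weight w n.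
Proof.
rewrite (max_weightE lyN) //; apply: eq_per => i v.
by rewrite nth_two_nseq ltn_ord.
Qed.

Lemma max_weight0 : max_weight w 0 = 0.
Proof.
have weight0 P : lpath_weight (l := 0) w P = 0 by apply: big_ord0.
apply/le_anti/andP; split.
  by apply: ge_ereal_sup => _ [P _ <-]; rewrite weight0.
have noP (a : 'I_0) : walk N by case: a.
rewrite -(weight0 noP); apply: ereal_sup_ubound; exists noP => //.
by split; case.
Qed.

Lemma has_max_weightsE (v : 'rV[R]_n) l : has_max_weights w v ->
  (l <= n)%N -> max_weight w l = (partial_sum v l)%:E.
Proof.
(* The vector of maximal weights starts at one path, so the value for no path is treated apart. *)
move=> wv; case: l => [|l] ln.
  by rewrite max_weight0 /partial_sum big_pred0.
have : map_mx EFin (partial_sums v) 0%R (Ordinal ln) =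
  max_weights w 0%R (Ordinal ln) by rewrite wv.
by rewrite !mxE.
Qed.

Lemma partial_sum_full (v : 'rV[R]_n) : partial_sum v n = (\sum_i v 0 i)%R.
Proof. by apply: eq_bigl => i; rewrite ltn_ord. Qed.

Lemma per_lty t : weighting w -> per w t < +oo.
Proof.
move=> w_fin; rewrite /per.
have [f _ ->] := tper_attained (path_matrix w t) erefl.
apply: lte_sum_pinfty => v _; rewrite /path_matrix.
case: pickP => [i _|_]; first by case: ifP; rewrite ?ltry ?ltNyr.
case: ifP => _; first exact: ltry.
by have [->|[e [_ _ ->]]] := link_attained w v (f v); rewrite ?ltNyr.
Qed.

End OneNetwork.
End Boundary.

(** * Three networks *)

Local Notation c0 := (0%R : 'I_4).
Local Notation c1 := (1%R : 'I_4).
Local Notation c2 := (2%R : 'I_4).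
Local Notation c3 := (3%R : 'I_4).

Lemma ord4P (c : 'I_4) : [\/ c = c0, c = c1, c = c2 | c = c3].
Proof.
by case: c => [[|[|[|[|//]]]] c_lt];
  [constructor 1|constructor 2|constructor 3|constructor 4]; apply: val_inj.
Qed.

Section TwoNetworks.
Variables (R : realType) (n : nat) (N1 N2 : network n) (r1 r2 : R)
  (ht1 : vertex N1 -> R) (ht2 : vertex N2 -> R).
Hypotheses (ly1 : layered r1 ht1) (ly2 : layered r2 ht2).
Variables (w1 : edge N1 -> \bar R) (w2 : edge N2 -> \bar R).

Lemma sink_concat_inl v :
  (inl v \in codom (@sink n (concat N1 N2))) = false.
Proof.
apply/negP => /codomP[i /=].
have [[j e]|[u ->]] := codom_sourceP (sink i : vertex N2).
  by have := source_neq_sink ly2 j i; rewrite e eqxx.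
by rewrite glue_nonsource.
Qed.

Lemma per_continued (K : Type) (T : K -> pred (vertex (concat N1 N2)))
    (c0 c d : K) l : (l <= n)%N ->
  (forall v, T c (inl v) = false) ->
  (forall v, T d (inl v) = (v \in codom (@sink n N1))) ->
  (forall v, T c (glue N1 v) = (v \in codom (@sink n N2))) ->
  (forall v, T d (glue N1 v) = (v \in codom (@source n N2))) ->
  per (concat_weight w1 w2) (fun i => T (nth c0 (nseq l c ++ nseq (n - l) d) i))
  = max_weight w1 n + max_weight w2 l.
Proof.
move=> ln Tc1 Td1 Tc2 Td2.
rewrite (per_concat_right ly1 ly2) => [|i v vN]; last first.
  by rewrite nth_two_nseq; case: ifP => _; rewrite ?Tc1 // Td1 (negbTE vN).
rewrite (per_sinks_max ly1); congr (_ + _).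
exact: (per_start_or_end ly2 w2 (T := fun c v => T c (glue N1 v))).
Qed.

(** The trace equalities come from here: [n] disjoint paths use every glued vertex. *)
Lemma max_weight_concat :
  max_weight (concat_weight w1 w2) n = max_weight w1 n + max_weight w2 n.
Proof.
rewrite -(per_sinks_max (layered_concat ly1 ly2)) (per_concat_right ly1 ly2).
  rewrite (per_sinks_max ly1) -(per_sinks_max ly2); congr (_ + _).
  apply: eq_per => i v; rewrite /sinks /=.
  exact: (mem_codom_inj (glue_inj ly1 ly2)).
by move=> i v _; apply: sink_concat_inl.
Qed.

End TwoNetworks.

Section ThreeNetworks.
Variables (R : realType) (n : nat) (N1 N2 N3 : network n) (r1 r2 r3 : R)
  (ht1 : vertex N1 -> R) (ht2 : vertex N2 -> R) (ht3 : vertex N3 -> R).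
Hypotheses (ly1 : layered r1 ht1) (ly2 : layered r2 ht2) (ly3 : layered r3 ht3).
Variables (w1 : edge N1 -> \bar R) (w2 : edge N2 -> \bar R)
  (w3 : edge N3 -> \bar R).
Notation N12 := (concat N1 N2).
Notation N23 := (concat N2 N3).
Notation N123 := (concat N12 N3).
Notation w12 := (concat_weight w1 w2).
Notation w23 := (concat_weight w2 w3).
Notation w123 := (concat_weight w12 w3).

Let ly12 := layered_concat ly1 ly2.
Let ly23 := layered_concat ly2 ly3.
Let ly123 := layered_concat ly12 ly3.

(* Class 0 marks the unused sources, class c > 0 the ends of the paths that
   stop at the sinks of the c-th network. *)
Definition terminal_vertex (c : 'I_4) (i : 'I_n) : vertex N123 :=
  match val c with
  | 0%N => source i
  | 1%N => inl (inl (sink i))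
  | 2%N => inl (sink i)
  | _ => sink i
  end.

Definition terminal (c : 'I_4) : pred (vertex N123) :=
  [in codom (terminal_vertex c)].

Definition per_classes (s : seq 'I_4) : \bar R :=
  per w123 (fun i => terminal (nth c0 s i)).

Notation two_classes l c d := (nseq l c ++ nseq (n - l) d).

Lemma terminal0 : terminal c0 =1 [in codom (@source n N123)].
Proof. by []. Qed.

Lemma terminal1 :
  terminal c1 =1 [in codom (fun i => inl (inl (sink i)) : vertex N123)].
Proof. by []. Qed.

Lemma terminal2 :
  terminal c2 =1 [in codom (fun i => inl (sink i) : vertex N123)].
Proof. by []. Qed.

Lemma terminal3 : terminal c3 =1 [in codom (@sink n N123)].
Proof. by []. Qed.

Lemma inl_codomF (A B : eqType) (f : 'I_n -> A) (b : B) :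
  (inr b \in codom (fun i => inl (f i) : A + B)) = false.
Proof. by apply/negP => /codomP[]. Qed.

Lemma inl_codom (A B : eqType) (f : 'I_n -> A) (a : A) :
  (inl a \in codom (fun i => inl (f i) : A + B)) = (a \in codom f).
Proof. exact: (mem_codom_inj (@inl_inj A B)). Qed.

Variable l : nat.
Hypothesis ln : (l <= n)%N.

(** This and the next five lemmas treat the edges of the tetrahedron. Networks beyond the last
    terminal are stripped off, and networks crossed by all paths split off. *)
Lemma per_classes30 : per_classes (two_classes l c3 c0) = max_weight w123 l.
Proof.
exact: (per_start_or_end ly123 w123 (T := terminal)).
Qed.

Lemma per_classes20 : per_classes (two_classes l c2 c0) = max_weight w12 l.
Proof.
rewrite /per_classes (per_concat_left ly12 ly3) => [|i u]; last first.
  rewrite nth_two_nseq; case: ifP => _; rewrite ?terminal2 ?terminal0 //=;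
    exact: inl_codomF.
apply: (per_start_or_end ly12 w12 (T := fun c v => terminal c (inl v))) => // v.
  rewrite terminal2; exact: inl_codom.
rewrite terminal0; exact: inl_codom.
Qed.

Lemma per_classes10 : per_classes (two_classes l c1 c0) = max_weight w1 l.
Proof.
rewrite /per_classes (per_concat_left ly12 ly3) => [|i u]; last first.
  rewrite nth_two_nseq; case: ifP => _; rewrite ?terminal1 ?terminal0 //=;
    exact: inl_codomF.
rewrite (per_concat_left ly1 ly2) => [|i u]; last first.
  rewrite nth_two_nseq; case: ifP => _;
    rewrite ?terminal1 ?terminal0 /= inl_codom;
    exact: inl_codomF.
apply: (per_start_or_end ly1 w1
  (T := fun c v => terminal c (inl (inl v)))) => // v.
  by rewrite terminal1 /= !inl_codom.
by rewrite terminal0 /= !inl_codom.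
Qed.

Lemma per_classes21 :
  per_classes (two_classes l c2 c1) = max_weight w1 n + max_weight w2 l.
Proof.
rewrite /per_classes (per_concat_left ly12 ly3) => [|i u]; last first.
  rewrite nth_two_nseq; case: ifP => _; rewrite ?terminal2 ?terminal1 //=;
    exact: inl_codomF.
apply: (per_continued ly1 ly2 w1 w2
  (T := fun c v => terminal c (inl v))) => // v.
- by rewrite terminal2 /= inl_codom (sink_concat_inl ly2).
- by rewrite terminal1 /= !inl_codom.
- rewrite terminal2 /= inl_codom.
  exact: (mem_codom_inj (glue_inj ly1 ly2)).
- rewrite terminal1 /= inl_codom.
  apply: (mem_codom_inj (glue_inj ly1 ly2)) => // i.
  by rewrite (glue_source N1 ly2).
Qed.

Lemma per_classes32 :
  per_classes (two_classes l c3 c2) =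
  max_weight w1 n + max_weight w2 n + max_weight w3 l.
Proof.
rewrite -(max_weight_concat ly1 ly2).
apply: (per_continued ly12 ly3 w12 w3 (T := terminal)) => // v.
- by rewrite terminal3 (sink_concat_inl ly3).
- by rewrite terminal2 /= inl_codom.
- rewrite terminal3 /=.
  exact: (mem_codom_inj (glue_inj ly12 ly3)).
- rewrite terminal2 /=.
  apply: (mem_codom_inj (glue_inj ly12 ly3)) => // i.
  by rewrite (glue_source N12 ly3).
Qed.

(** Classes 1 and 3 require a cut after [N1], hence the other bracketing. *)
Lemma per_classes31 :
  per_classes (two_classes l c3 c1) = max_weight w1 n + max_weight w23 l.
Proof.
rewrite /per_classes (per_concat_assoc ly1 ly2 ly3).
apply: (per_continued ly1 ly23 w1 w23
  (T := fun c v => terminal c (assoc v))) => // v.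
- by rewrite terminal3; exact: (sink_concat_inl ly3).
- by rewrite terminal1 /= !inl_codom.
- rewrite (assoc_glue N1 ly2 ly3) terminal3 /=.
  apply: (mem_codom_inj (inr_assoc_inj ly1 ly2)) => // i.
  by rewrite /= (inr_assoc_glue N1 N2 ly3).
- rewrite (assoc_glue N1 ly2 ly3) terminal1 /=.
  apply: (mem_codom_inj (inr_assoc_inj ly1 ly2)) => // i.
  by rewrite /= (glue_source N1 ly2).
Qed.

End ThreeNetworks.

(** * The tropical Pluecker relation for multisets of classes *)

Section Classes.
Variables (R : realType) (n : nat) (N1 N2 N3 : network n) (r1 r2 r3 : R)
  (ht1 : vertex N1 -> R) (ht2 : vertex N2 -> R) (ht3 : vertex N3 -> R).
Hypotheses (ly1 : layered r1 ht1) (ly2 : layered r2 ht2) (ly3 : layered r3 ht3).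
Variables (w1 : edge N1 -> \bar R) (w2 : edge N2 -> \bar R)
  (w3 : edge N3 -> \bar R).
Notation F := (per_classes w1 w2 w3).

Let ly123 := layered_concat (layered_concat ly1 ly2) ly3.

Lemma per_classes_perm s s' : size s = n -> perm_eq s s' -> F s = F s'.
Proof. exact: (per_perm_eq ly123). Qed.

(** The two assignments agree beyond the first two labels. The exchange starts at the first one, and
    the alternatives are [q = p] and [q = p']. *)
Lemma per_classes_exchange (a b c d : 'I_4) (y : seq 'I_4) :
  (size y + 2 = n)%N ->
  F [:: a, d & y] + F [:: b, c & y] <= F [:: b, d & y] + F [:: a, c & y] \/
  F [:: a, d & y] + F [:: b, c & y] <= F [:: c, d & y] + F [:: b, a & y].
Proof.
move=> yn.
have n0 : (0 < n)%N by rewrite -yn addn2.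
have n1 : (1 < n)%N by rewrite -yn addn2.
pose p := Ordinal n0; pose p' := Ordinal n1.
pose D : {set 'I_n} := p |: finset.set1 p'.
have [||q qD le12] := @per_exchange _ _ _ _ _ ly123
  (concat_weight (concat_weight w1 w2) w3) _ (@terminal n N1 N2 N3)
  (fun i : 'I_n => nth c0 [:: a, d & y] i)
  (fun i : 'I_n => nth c0 [:: b, c & y] i) D p.
- by rewrite !inE eqxx.
- by case=> [[|[|i]] i_lt]; rewrite !inE -!val_eqE.
have E k s : (forall i : 'I_n, k i = nth c0 s i) ->
    per (concat_weight (concat_weight w1 w2) w3)
      (fun i => @terminal n N1 N2 N3 (k i)) = F s.
  by move=> ks; apply: eq_per => i v; rewrite ks.
move: qD; rewrite !inE => /orP[] /eqP qE; [left|right];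
  apply: le_trans le12 _; rewrite qE.
  by rewrite (E _ [:: b, d & y]) ?(E _ [:: a, c & y]) //;
    case=> [[|[|i]] i_lt]; rewrite -val_eqE.
by rewrite (E _ [:: c, d & y]) ?(E _ [:: b, a & y]) //;
  case=> [[|[|i]] i_lt]; rewrite -val_eqE.
Qed.

End Classes.

Section FinNum.
Variables (R : realType) (n : nat) (N1 N2 N3 : network n) (r1 r2 r3 : R)
  (ht1 : vertex N1 -> R) (ht2 : vertex N2 -> R) (ht3 : vertex N3 -> R).
Hypotheses (ly1 : layered r1 ht1) (ly2 : layered r2 ht2) (ly3 : layered r3 ht3).
Variables (w1 : edge N1 -> \bar R) (w2 : edge N2 -> \bar R)
  (w3 : edge N3 -> \bar R).
Let ly123 := layered_concat (layered_concat ly1 ly2) ly3.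

(** By [per_neqNy] constant assignments suffice: class [c0] gives the empty family, the others give
    [n] paths through the first, the first two or all three networks. *)
Lemma per_classes_fin_num s :
  weighting w1 -> weighting w2 -> weighting w3 ->
  max_weight w1 n != -oo -> max_weight (concat_weight w1 w2) n != -oo ->
  max_weight (concat_weight (concat_weight w1 w2) w3) n != -oo ->
  per_classes w1 w2 w3 s \is a fin_num.
Proof.
move=> w1_lt w2_lt w3_lt fin1 fin2 fin3.
rewrite fin_numE -ltey; apply/andP; split; last first.
  by apply: per_lty => -[[e|e]|e] /=.
apply: (per_neqNy ly123 (T := @terminal n N1 N2 N3) c0
  (fun i : 'I_n => nth c0 s i)) => c.
pose F l c d := per_classes w1 w2 w3 (nseq l c ++ nseq (n - l) d).
have E l d : (l == n) || (c == d) ->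
    per (concat_weight (concat_weight w1 w2) w3) (fun=> terminal c) = F l c d.
  move=> lcd; apply: eq_per => i v; rewrite nth_two_nseq.
  by move: lcd => /orP[/eqP->|/eqP->]; rewrite ?ltn_ord ?if_same.
have [e|e|e|e] := ord4P c.
- have := per_classes10 ly1 ly2 ly3 w1 w2 w3 (leq0n n).
  by rewrite max_weight0 (E 0%N c0) ?e ?eqxx ?orbT // /F /= => ->.
- by rewrite (E n c0) ?eqxx // e /F (per_classes10 ly1 ly2 ly3).
- by rewrite (E n c0) ?eqxx // e /F (per_classes20 ly1 ly2 ly3).
- by rewrite (E n c0) ?eqxx // e /F (per_classes30 ly1 ly2 ly3).
Qed.

End FinNum.

(** * Points of the tetrahedron as multisets of classes *)

Definition class_seq (x0 x1 x2 x3 : nat) : seq 'I_4 :=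
  nseq x1 c1 ++ nseq x2 c2 ++ nseq x3 c3 ++ nseq x0 c0.

Lemma count_class_seq x0 x1 x2 x3 (c : 'I_4) :
  count_mem c (class_seq x0 x1 x2 x3) = nth 0%N [:: x0; x1; x2; x3] c.
Proof.
rewrite /class_seq !count_cat !count_nseq.
by have [->|->|->|->] := ord4P c; rewrite /= !(mul0n, mul1n, addn0, add0n).
Qed.

Lemma size_class_seq x0 x1 x2 x3 :
  size (class_seq x0 x1 x2 x3) = (x0 + x1 + x2 + x3)%N.
Proof. by rewrite !size_cat !size_nseq; lia. Qed.

Lemma perm_eq_count_mem (T : eqType) (s s' : seq T) :
  (forall c, count_mem c s = count_mem c s') -> perm_eq s s'.
Proof. by move=> ss'; apply/allP => c _; rewrite /= ss'. Qed.

Lemma sum_ord4 (y : 'I_4 -> nat) :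
  (\sum_(i < 4) y i = y c0 + y c1 + y c2 + y c3)%N.
Proof.
rewrite !big_ord_recl big_ord0 addn0 !addnA.
by congr (_ + _ + _ + _)%N; congr y; apply: val_inj.
Qed.

Definition row_seq (x : 'rV[nat]_4) : seq 'I_4 :=
  class_seq (x 0%R c0) (x 0%R c1) (x 0%R c2) (x 0%R c3).

Lemma count_row_seq x c : count_mem c (row_seq x) = x 0%R c.
Proof. by rewrite count_class_seq; have [->|->|->|->] := ord4P c. Qed.

Lemma size_row_seq x : size (row_seq x) = (\sum_(i < 4) x 0%R i)%N.
Proof. by rewrite size_class_seq sum_ord4. Qed.

Lemma perm_row_seq_unit_vec x a :
  perm_eq (row_seq (x + unit_vec a)%R) (a :: row_seq x).
Proof.
apply: perm_eq_count_mem => c; rewrite /= !count_row_seq !mxE eqxx /= eq_sym.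
by rewrite addnC; case: (a == c).
Qed.

Local Close Scope ereal_scope.

Local Ltac class_count :=
  let c := fresh in move=> c; have [->|->|->|->] := ord4P c => /=; lia.

Theorem theorem2p6 (R : realType) (n : nat) (P1 P2 P3 : planar_network R n)
    (lambda mu nu rho sigma tau : 'rV[R]_n) :
  mHorn P1 P2 P3 lambda mu nu rho sigma tau ->
  [/\ \sum_i lambda 0 i + \sum_i mu 0 i = \sum_i rho 0 i,
      \sum_i mu 0 i + \sum_i nu 0 i = \sum_i sigma 0 i
    & \sum_i lambda 0 i + \sum_i mu 0 i + \sum_i nu 0 i = \sum_i tau 0 i] /\
  exists m : nat -> nat -> nat -> R,
    (m 0%N 0%N 0%N = 0 /\
     forall l : nat, (l <= n)%N ->
       [/\ m l 0%N 0%N = partial_sum lambda l,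
           m (n - l)%N l 0%N = \sum_i lambda 0 i + partial_sum mu l
         & m 0%N (n - l)%N l =
             \sum_i lambda 0 i + \sum_i mu 0 i + partial_sum nu l] /\
       [/\ m 0%N l 0%N = partial_sum rho l,
           m (n - l)%N 0%N l = \sum_i lambda 0 i + partial_sum sigma l
         & m 0%N 0%N l = partial_sum tau l]) /\
    (forall short1 short2 long1 long2 : 'rV[nat]_4,
       small_rhombus n short1 short2 long1 long2 ->
       value_at m long1 + value_at m long2
         <= value_at m short1 + value_at m short2) /\
    (forall i j k : nat, (i + j + k + 2 <= n)%N ->
       let alpha := m i.+1 j k + m i j.+1 k.+1 in
       let beta := m i.+1 j.+1 k + m i j k.+1 in
       let gamma := m i j.+1 k + m i.+1 j k.+1 in
       [/\ alpha <= Num.max beta gamma,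
           beta <= Num.max gamma alpha
         & gamma <= Num.max alpha beta]).
Proof.
move=> [w1 [w2 [w3 [[w1_lt w2_lt w3_lt] [[h1 h2 h3] [h12 h23 h123]]]]]].
have ly1 := planar_layered (embedding P1).
have ly2 := planar_layered (embedding P2).
have ly3 := planar_layered (embedding P3).
have ly12 := layered_concat ly1 ly2.
have sum1 : max_weight w1 n = (\sum_i lambda 0 i)%:E.
  by rewrite (has_max_weightsE h1) // partial_sum_full.
have sum2 : max_weight w2 n = (\sum_i mu 0 i)%:E.
  by rewrite (has_max_weightsE h2) // partial_sum_full.
have sum3 : max_weight w3 n = (\sum_i nu 0 i)%:E.
  by rewrite (has_max_weightsE h3) // partial_sum_full.
split.
  have := max_weight_concat ly1 ly2 w1 w2.
  have := max_weight_concat ly2 ly3 w2 w3.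
  have := max_weight_concat ly12 ly3 (concat_weight w1 w2) w3.
  rewrite sum1 sum2 sum3.
  rewrite (has_max_weightsE h12) // (has_max_weightsE h23) //.
  rewrite (has_max_weightsE h123) // !partial_sum_full -!EFinD.
  by move=> [tauE] [sigmaE] [rhoE]; rewrite tauE rhoE sigmaE.
(* All values are finite, so the relations descend from [\bar R] to [R]. *)
pose F := per_classes w1 w2 w3.
pose G s : R := fine (F s).
have FE s : F s = (G s)%:E.
  rewrite /G fineK // (per_classes_fin_num ly1 ly2 ly3) //.
  - by rewrite sum1.
  - by rewrite (has_max_weightsE h12).
  - by rewrite (has_max_weightsE h123).
have G_perm s s' : perm_eq s s' -> size s = n -> G s = G s'.
  by move=> ss' sn; rewrite /G /F (per_classes_perm ly1 ly2 ly3 _ _ _ sn ss').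
have plucker a b c d y : (size y + 2 = n)%N ->
    G [:: a, d & y] + G [:: b, c & y] <= G [:: b, d & y] + G [:: a, c & y] \/
    G [:: a, d & y] + G [:: b, c & y] <= G [:: c, d & y] + G [:: b, a & y].
  move=> yn; have := per_classes_exchange ly1 ly2 ly3 w1 w2 w3 a b c d yn.
  by rewrite -/F !FE -!EFinD !lee_fin.
have swap a b y : (size y + 2 = n)%N -> G [:: a, b & y] = G [:: b, a & y].
  move=> yn; apply: G_perm; last by rewrite /= -addn2.
  exact: (permEl (perm_catCA [:: a] [:: b] y)).
(* Only two classes occur on an edge; the multisets are compared by counting each class. *)
have bd l c d x0 x1 x2 x3 x : (l <= n)%N ->
    F (nseq l c ++ nseq (n - l) d) = x%:E ->
    (forall e : 'I_4, nth 0%N [:: x0; x1; x2; x3] e =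
       (c == e) * l + (d == e) * (n - l))%N ->
    G (class_seq x0 x1 x2 x3) = x.
  move=> ln Fx cE; rewrite -[x]/(fine x%:E) -Fx -/(G _); apply/esym/G_perm.
    apply: perm_eq_count_mem => e.
    by rewrite count_class_seq cE count_cat !count_nseq.
  by rewrite size_cat !size_nseq subnKC.
exists (fun i j k => G (class_seq (n - i - j - k) i j k)).
have bdE l : (l <= n)%N -> _ := fun ln =>
  (per_classes10 ly1 ly2 ly3 w1 w2 w3 ln,
   per_classes21 ly1 ly2 ly3 w1 w2 w3 ln,
   per_classes32 ly1 ly2 ly3 w1 w2 w3 ln,
   per_classes20 ly1 ly2 ly3 w1 w2 w3 ln,
   per_classes31 ly1 ly2 ly3 w1 w2 w3 ln,
   per_classes30 ly1 ly2 ly3 w1 w2 w3 ln).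
have maxE l : (l <= n)%N -> _ := fun ln =>
  (has_max_weightsE h1 ln, has_max_weightsE h2 ln, has_max_weightsE h3 ln,
   has_max_weightsE h12 ln, has_max_weightsE h23 ln, has_max_weightsE h123 ln).
split; [split|split].
- apply: (bd 0%N c1 c0) => //.
    by rewrite /F bdE // max_weight0.
  by class_count.
- move=> l ln; split; split.
  + apply: (bd l c1 c0) => //; first by rewrite /F bdE // maxE.
    by class_count.
  + apply: (bd l c2 c1) => //; first by rewrite /F bdE // sum1 maxE.
    by class_count.
  + apply: (bd l c3 c2) => //; first by rewrite /F bdE // sum1 sum2 maxE.
    by class_count.
  + apply: (bd l c2 c0) => //; first by rewrite /F bdE // maxE.
    by class_count.
  + apply: (bd l c3 c1) => //; first by rewrite /F bdE // sum1 maxE.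
    by class_count.
  + apply: (bd l c3 c0) => //; first by rewrite /F bdE // maxE.
    by class_count.
- move=> s1 s2 l1 l2 [a [b [c [y [_ [yn [-> -> -> ->]]]]]]].
  have size_y : (size (row_seq y) + 2 = n)%N by rewrite size_row_seq.
  have valE u v : value_at (fun i j k => G (class_seq (n - i - j - k) i j k))
      (y + unit_vec u + unit_vec v) = G [:: u, v & row_seq y].
    set x := y + _ + _.
    have x_perm : perm_eq (row_seq x) [:: u, v & row_seq y].
      apply: perm_trans (perm_row_seq_unit_vec _ _) _.
      rewrite perm_sym.
      apply: perm_trans (permEl (perm_catCA [:: u] [:: v] _)) _.
      by rewrite perm_cons perm_sym perm_row_seq_unit_vec.
    have x_size : size (row_seq x) = n by rewrite (perm_size x_perm) /= -addn2.
    rewrite -(G_perm _ _ x_perm x_size) /value_at.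
    congr (G (class_seq _ _ _ _)).
    by move: x_size; rewrite size_class_seq; lia.
  (* With [d = a], both alternatives have the short diagonal on the right, up to order. *)
  rewrite mulr2n addrA !valE.
  have [] := plucker a b c a _ size_y; rewrite ?(swap b a) ?(swap c a) //.
  by rewrite [leRHS]addrC.
- move=> i j k ijk.
  (* The six points share [y]; each adds two of the four classes to it. *)
  pose y := class_seq (n - 2 - i - j - k) i j k.
  have size_y : (size y + 2 = n)%N by rewrite size_class_seq; lia.
  have valE u v x0 x1 x2 x3 : (x0 + x1 + x2 + x3 = n)%N ->
      (forall c : 'I_4, nth 0%N [:: x0; x1; x2; x3] c = (u == c) + ((v == c) +
         nth 0%N [:: n - 2 - i - j - k; i; j; k] c))%N ->
      G (class_seq x0 x1 x2 x3) = G [:: u, v & y].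
    move=> xn cE; apply: G_perm; last by rewrite size_class_seq.
    by apply: perm_eq_count_mem => c; rewrite /= !count_class_seq cE.
  have m01 : G (class_seq (n - i.+1 - j - k) i.+1 j k) = G [:: c1, c0 & y].
    by apply: valE; [lia|class_count].
  have m23 : G (class_seq (n - i - j.+1 - k.+1) i j.+1 k.+1) =
      G [:: c2, c3 & y].
    by apply: valE; [lia|class_count].
  have m12 : G (class_seq (n - i.+1 - j.+1 - k) i.+1 j.+1 k) =
      G [:: c1, c2 & y].
    by apply: valE; [lia|class_count].
  have m03 : G (class_seq (n - i - j - k.+1) i j k.+1) = G [:: c3, c0 & y].
    by apply: valE; [lia|class_count].
  have m02 : G (class_seq (n - i - j.+1 - k) i j.+1 k) = G [:: c2, c0 & y].
    by apply: valE; [lia|class_count].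
  have m13 : G (class_seq (n - i.+1 - j - k.+1) i.+1 j k.+1) =
      G [:: c1, c3 & y].
    by apply: valE; [lia|class_count].
  (* [alpha], [beta] and [gamma] are the three pairings of the four classes; [plucker] bounds each
     pairing by one of the other two. *)
  rewrite /= m01 m23 m12 m03 m02 m13 !le_max; split; apply/orP.
  + have [] := plucker c1 c2 c3 c0 _ size_y => le12; [right|left] => //.
    by rewrite (swap c1 c2) // [leRHS]addrC.
  + have [] := plucker c1 c3 c0 c2 _ size_y => le12; [right|left].
      by rewrite (swap c2 c3) // [leRHS]addrC.
    by rewrite (swap c2 c0) // (swap c1 c3).
  + have [] := plucker c2 c1 c3 c0 _ size_y => le12; [left|right] => //.
    by rewrite [leRHS]addrC.
Qed.
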